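(* Let $n\ge 2$ and let $M$ be an $n$-dimensional hypersurface with constant mean curvature $H$ in the Riemannian product $\mathbb{H}^n\times\mathbb{R}$, foliated by $(n-1)$-dimensional spheres in parallel horizontal hyperplanes. If either $H\neq 0$, or $H=0$ and $n\geq 3$, then $M$ is a rotationally symmetric hypersurface.
   Context: $\mathbb{H}^n=\{(x_1,\dots,x_n)\in\mathbb{R}^n : x_n>0\}$ is the upper half-space model of hyperbolic space with metric $ds^2=\frac{(dx_1)^2+\cdots+(dx_n)^2}{x_n^2}$. The Riemannian product $\mathbb{H}^n\times\mathbb{R}$ carries the metric $ds^2+dt^2$, where $t$ is the coordinate on $\mathbb{R}$. The parallel horizontal hyperplanes are the slices $\mathbb{H}^n\times\{t\}$, $t\in\mathbb{R}$. $M$ is foliated by spheres in parallel horizontal hyperplanes if $M$ is a smooth one-parameter family, with $t$ ranging over an interval $I\subset\mathbb{R}$, of $(n-1)$-dimensional spheres $M\cap(\mathbb{H}^n\times\{t\})$, $t\in I$, each being a hyperbolic geodesic sphere (of positive radius) in $\mathbb{H}^n\times\{t\}$ (circles when $n=2$); in the upper half-space model these are exactly the Euclidean round spheres contained in $\{x_n>0\}$. Mean curvature: where $M$ is locally the level set of a smooth function $f$ with nonvanishing gradient, oriented by the unit normal $N=-\nabla f/|\nabla f|$, the mean curvature $H$ is given by $nH=-\operatorname{div}\frac{\nabla f}{|\nabla f|}$, where $\nabla$ and $\operatorname{div}$ are the gradient and divergence of $\mathbb{H}^n\times\mathbb{R}$. $M$ (foliated by the spheres $M\cap(\mathbb{H}^n\times\{t\})$,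 $t\in I$, in parallel horizontal hyperplanes) is rotationally symmetric if the hyperbolic centers of all the spheres $M\cap(\mathbb{H}^n\times\{t\})$ lie on a single vertical geodesic $\{p\}\times\mathbb{R}$, $p\in\mathbb{H}^n$ (the rotation axis); equivalently, $M$ is invariant under all rotations of $\mathbb{H}^n$ about $p$ acting on the first factor. *)

(* Defs.v *)
From HB Require Import structures.
From mathcomp Require Import all_boot all_order all_algebra.
From mathcomp Require Import all_classical all_reals all_analysis.

Set Implicit Arguments.
Unset Strict Implicit.
Unset Printing Implicit Defensive.

Import Order.TTheory GRing.Theory Num.Theory.
Import numFieldNormedType.Exports.

Local Open Scope classical_set_scope.
Local Open Scope ring_scope.

Section Smoothness.
Variable R : realType.

Definition pderiv d (i : 'I_d) (f : 'rV[R]_d -> R) : 'rV[R]_d -> R :=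
  'D_(delta_mx 0 i) f.

(* Meant for open [U]: all iterated partial derivatives up to order [k] exist
   and are continuous on [U]. *)
Fixpoint Ck_on d (k : nat) (U : set 'rV[R]_d) (f : 'rV[R]_d -> R) : Prop :=
  (forall x, U x -> {for x, continuous f}) /\
  (if k is k'.+1 then
     forall i : 'I_d, (forall x, U x -> derivable f x (delta_mx 0 i)) /\
                      Ck_on k' U (pderiv i f)
   else True).

Definition smooth_on d (U : set 'rV[R]_d) (f : 'rV[R]_d -> R) : Prop :=
  forall k, Ck_on k U f.

(* Smoothness on an arbitrary [I]: smoothness on an open neighbourhood of it. *)
Definition smooth1_on (I : set R) (f : R -> R) : Prop :=
  exists J : set R, [/\ open J, I `<=` J &
    forall (k : nat) t, J t -> derivable (derive1n k f) t 1].

End Smoothness.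

(* A metric on an open subset of R^d is given by its coefficient matrices. *)
Section Riemannian.
Variables (R : realType) (d : nat) (g : 'rV[R]_d -> 'M[R]_d).

Definition rnorm (x v : 'rV[R]_d) : R := Num.sqrt ((v *m g x *m v^T) 0 0).

(* (grad f)^i = g^{ij} d_j f *)
Definition rgrad (f : 'rV[R]_d -> R) (x : 'rV[R]_d) : 'rV[R]_d :=
  (\row_j pderiv j f x) *m invmx (g x).

(* div X = |g|^{-1/2} d_i (|g|^{1/2} X^i) *)
Definition rdiv (X : 'rV[R]_d -> 'rV[R]_d) (x : 'rV[R]_d) : R :=
  (Num.sqrt (\det (g x)))^-1 *
  \sum_(i < d) pderiv i (fun y => Num.sqrt (\det (g y)) * X y 0 i) x.

Definition unit_grad (f : 'rV[R]_d -> R) (x : 'rV[R]_d) : 'rV[R]_d :=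
  (rnorm x (rgrad f x))^-1 *: rgrad f x.

(* Inside the open set [U], which lies in the domain [D] of the metric, [M] is
   the zero set of the smooth function [f], which has no critical point. *)
Definition local_equation (D M U : set 'rV[R]_d) (f : 'rV[R]_d -> R) : Prop :=
  [/\ open U, U `<=` D, smooth_on U f, (forall x, U x -> rgrad f x != 0) &
      M `&` U = [set x | U x /\ f x = 0]].

Definition oriented_by (M U : set 'rV[R]_d) (N : 'rV[R]_d -> 'rV[R]_d)
    (f : 'rV[R]_d -> R) : Prop :=
  forall x, (M `&` U) x -> N x = - unit_grad f x.

(* [M] is an embedded smooth hypersurface of [D] with unit normal field [N]. *)
Definition oriented_hypersurface (D M : set 'rV[R]_d)
    (N : 'rV[R]_d -> 'rV[R]_d) : Prop :=
  M `<=` D /\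
  forall x, M x -> exists (U : set 'rV[R]_d) (f : 'rV[R]_d -> R),
    [/\ U x, local_equation D M U f & oriented_by M U N f].

(* [h] is the mean curvature function of [M] with respect to [N]; the value of
   the divergence on [M] depends only on [M] and [N], not on the choice of the
   local equation [f]. The dimension of [M] is [d.-1]. *)
Definition mean_curvature (D M : set 'rV[R]_d) (N : 'rV[R]_d -> 'rV[R]_d)
    (h : 'rV[R]_d -> R) : Prop :=
  forall (U : set 'rV[R]_d) (f : 'rV[R]_d -> R),
    local_equation D M U f -> oriented_by M U N f ->
    forall x, (M `&` U) x -> d.-1%:R * h x = - rdiv (unit_grad f) x.

End Riemannian.

(* Upper half-space model of hyperbolic space, of dimension [n = m.+1]. *)
Section HyperbolicSpace.
Variables (R : realType) (m : nat).
Local Notation n := m.+1.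

Definition height (x : 'rV[R]_n) : R := x 0 ord_max.

Definition hyp : set 'rV[R]_n := [set x | 0 < height x].

Definition hyp_metric (x : 'rV[R]_n) : 'M[R]_n := (height x ^- 2)%:M.

Definition arcosh (u : R) : R := ln (u + Num.sqrt (u ^+ 2 - 1)).

(* Geodesic distance of [hyp_metric], in closed form. *)
Definition hyp_dist (x y : 'rV[R]_n) : R :=
  arcosh (1 + (\sum_(i < n) (x 0 i - y 0 i) ^+ 2) / (2 * height x * height y)).

Definition hyp_sphere (p : 'rV[R]_n) (r : R) : set 'rV[R]_n :=
  [set x | hyp x /\ hyp_dist x p = r].

(* Points of H^n x R are row vectors of size [n + 1]. *)
Definition horiz (z : 'rV[R]_(n + 1)) : 'rV[R]_n := lsubmx z.

Definition hypR : set 'rV[R]_(n + 1) := [set z | hyp (horiz z)].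

Definition hypR_metric (z : 'rV[R]_(n + 1)) : 'M[R]_(n + 1) :=
  block_mx (hyp_metric (horiz z)) 0 0 1%:M.

Definition slice (M : set 'rV[R]_(n + 1)) (t : R) : set 'rV[R]_n :=
  [set x | M (row_mx x t%:M)].

Definition foliated_by_spheres (M : set 'rV[R]_(n + 1)) (I : set R) : Prop :=
  is_interval I /\
  exists (p : R -> 'rV[R]_n) (r : R -> R),
    [/\ (forall i : 'I_n, smooth1_on I (fun t => p t 0 i)), smooth1_on I r,
        (forall t, I t ->
           [/\ hyp (p t), 0 < r t & slice M t = hyp_sphere (p t) (r t)]) &
        (forall t, ~ I t -> slice M t = set0)].

(* All the spheres [slice M t], [t] in [I], have the same hyperbolic centre. *)
Definition rotationally_symmetric (M : set 'rV[R]_(n + 1)) (I : set R) : Prop :=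
  exists2 q : 'rV[R]_n, hyp q &
    forall t, I t -> exists2 s : R, 0 < s & slice M t = hyp_sphere q s.

End HyperbolicSpace.

Arguments hyp {R m}.
Arguments hypR {R m}.
Arguments hyp_metric {R m}.
Arguments hypR_metric {R m}.

(* Main.v *)
Require Import Defs.
From mathcomp Require Import all_boot all_order all_algebra.
From mathcomp Require Import all_classical all_reals all_analysis.
From mathcomp Require Import complex.
From mathcomp Require Import lra ring.

(* In the half-space model the slices of [M] are Euclidean spheres
   [|x - c t|^2 = rho t], which gives a global equation of [M] whose mean
   curvature can be computed. With [y] the height of [x], [h] the last coordinate
   of [c t], [xi = x - c t] and [A = xi . c' + rho' / 2], the equation reads
     [n H (y^2 rho + A^2)^(3/2) = +- y ((n - 2) h A^2 + y K)]
   on each slice, where [K], like [y] and [A], is affine in [x]. Squared, this is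
   a polynomial identity on a real sphere, hence it also holds on the complexified
   sphere. The real sphere does not meet [y = 0] but its complexification does,
   and there the identity forces [A = 0] as soon as [H] or [n - 2] is nonzero.
   Looking at plane sections [A = 0] means that [c_i' = 0] for the horizontal
   coordinates and that [(h^2 - rho)' = 0]: the hyperbolic centre, whose height is
   [sqrt (h^2 - rho)], does not move. *)

Set Implicit Arguments.
Unset Strict Implicit.
Unset Printing Implicit Defensive.

Import Order.TTheory GRing.Theory Num.Theory.
Import numFieldNormedType.Exports.

Local Open Scope classical_set_scope.
Local Open Scope ring_scope.

(** * Calculus in R^d *)

Section DirectionalDerivative.
Variables (R : realType) (V : normedModType R).
Implicit Types (f u : V -> R) (x v : V).

(** Both sides have the same difference quotient. This reduces directional derivatives to
    one-variable calculus, in particular to its chain rule and mean value theorem. *)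
Lemma is_derive_lineP f x v (df : R) :
  is_derive x v f df <-> is_derive (0 : R) 1 (fun s => f (s *: v + x)) df.
Proof.
have E : (fun h : R => h^-1 *: ((f \o shift x) (h *: v) - f x)) =
   (fun h : R => h^-1 *: (((fun s : R => f (s *: v + x)) \o shift 0)
      (h *: (1 : R)) - f (0 *: v + x))).
  by apply/funext => h /=; rewrite scale0r add0r addr0 [_ *: 1]mulr1.
split=> -[]; rewrite /derivable /derive => D1 D2; split; rewrite /derivable /derive.
- by rewrite -E.
- by rewrite -E.
- by rewrite E.
- by rewrite E.
Qed.

Lemma is_derive_scomp (phi : R -> R) u x v (a b : R) :
  is_derive (u x) 1 phi a -> is_derive x v u b ->
  is_derive x v (fun y => phi (u y)) (a * b).
Proof.
move=> Dphi /is_derive_lineP Du; apply/is_derive_lineP.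
apply: (@is_derive1_comp _ phi (fun s => u (s *: v + x)) 0 a b).
by rewrite scale0r add0r.
Qed.

End DirectionalDerivative.

(** * Closure properties of [Ck_on] *)

Section CkClosure.
Variables (R : realType) (d : nat).
Implicit Types (U : set 'rV[R]_d) (f g : 'rV[R]_d -> R).

Lemma near_eq_on U f g x : open U -> (forall y, U y -> f y = g y) -> U x ->
  \near x, f x = g x.
Proof. by move=> oU fg Ux; have := open_nbhs_nbhs (conj oU Ux); exact: filterS. Qed.

Lemma near_eq_continuous_at f g x : (\near x, f x = g x) ->
  {for x, continuous f} -> {for x, continuous g}.
Proof.
move=> fg cf; rewrite /prop_for /continuous_at -(nbhs_singleton fg).
exact: cvg_trans (near_eq_cvg fg) cf.
Qed.

Lemma Ck_ext k U f g : open U -> (forall x, U x -> f x = g x) ->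
  Ck_on k U f -> Ck_on k U g.
Proof.
move=> oU; elim: k f g => [|k IH] f g fg /= [cf df].
  by split=> // x Ux; apply: near_eq_continuous_at (cf x Ux); exact: near_eq_on Ux.
split=> [x Ux|i].
  by apply: near_eq_continuous_at (cf x Ux); exact: near_eq_on Ux.
have [dfi Cf] := df i; split=> [x Ux|].
  by apply: near_eq_derivable (dfi x Ux); exact: near_eq_on Ux.
apply: IH Cf => x Ux; apply: near_eq_derive; exact: near_eq_on Ux.
Qed.

Lemma Ck_onW k U f : Ck_on k.+1 U f -> Ck_on k U f.
Proof.
elim: k f => [|k IH] f [cf df]; first by split.
by split=> // i; have [? ?] := df i; split=> //; exact: IH.
Qed.

Lemma Ck_cst k U (a : R) : Ck_on k U (cst a).
Proof.
elim: k a => [|k IH] a; first by split=> // x _; exact: cst_continuous.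
split=> [x _|i]; first exact: cst_continuous.
split=> [x _|]; first exact: derivable_cst.
suff -> : pderiv i (cst a) = cst 0 :> ('rV[R]_d -> R) by exact: IH.
by apply/funext => x; exact: derive_cst.
Qed.

Lemma is_derive_coord (x : 'rV[R]_d) (i j : 'I_d) :
  is_derive x (delta_mx 0 i) (fun y : 'rV[R]_d => y 0 j) (i == j)%:R.
Proof.
apply/is_derive_lineP.
have -> : (fun s : R => (s *: delta_mx 0 i + x) 0 j) =
   (fun s : R => (s * (i == j)%:R + x 0 j)).
  by apply/funext => s; rewrite !mxE eqxx eq_sym.
apply: is_derive_eq.
by rewrite /= scaler0 add0r addr0 [_ *: 1]mulr1.
Qed.

Lemma Ck_coord k U (j : 'I_d) : Ck_on k U (fun y : 'rV[R]_d => y 0 j).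
Proof.
case: k => [|k]; split=> //; try by move=> x _; exact: coord_continuous.
move=> i; split=> [x _|]; first by have [] := is_derive_coord x i j.
suff -> : pderiv i (fun y : 'rV[R]_d => y 0 j) = cst (i == j)%:R by exact: Ck_cst.
by apply/funext => x; exact: (@derive_val _ _ _ _ _ _ _ (is_derive_coord x i j)).
Qed.

Lemma Ck_add k U f g : open U -> Ck_on k U f -> Ck_on k U g ->
  Ck_on k U (fun x => f x + g x).
Proof.
move=> oU; elim: k f g => [|k IH] f g [cf df] [cg dg].
  by split=> // x Ux; apply: continuousD; [exact: cf|exact: cg].
split=> [x Ux|i]; first by apply: continuousD; [exact: cf|exact: cg].
have [dfi Cf] := df i; have [dgi Cg] := dg i; split=> [x Ux|].
  by apply: derivableD; [exact: dfi|exact: dgi].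
apply: (Ck_ext oU _ (IH _ _ Cf Cg)) => x Ux.
by rewrite /pderiv deriveD //; [exact: dfi|exact: dgi].
Qed.

Lemma Ck_mul k U f g : open U -> Ck_on k U f -> Ck_on k U g ->
  Ck_on k U (fun x => f x * g x).
Proof.
move=> oU; elim: k f g => [|k IH] f g Cf Cg.
  case: Cf Cg => [cf _] [cg _].
  by split=> // x Ux; apply: continuousM; [exact: cf|exact: cg].
have [[cf df] [cg dg]] := (Cf, Cg).
split=> [x Ux|i]; first by apply: continuousM; [exact: cf|exact: cg].
have [dfi Cfi] := df i; have [dgi Cgi] := dg i; split=> [x Ux|].
  by apply: derivableM; [exact: dfi|exact: dgi].
apply: (Ck_ext oU _ (Ck_add oU (IH _ _ (Ck_onW Cf) Cgi) (IH _ _ (Ck_onW Cg) Cfi))).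
by move=> x Ux; rewrite /pderiv deriveM //; [exact: dfi|exact: dgi].
Qed.

Lemma Ck_sum k U n (f : 'I_n -> 'rV[R]_d -> R) : open U ->
  (forall i, Ck_on k U (f i)) -> Ck_on k U (fun x => \sum_(i < n) f i x).
Proof.
move=> oU; elim: n f => [|n IH] f Cf.
  by apply: (Ck_ext oU _ (Ck_cst k U 0)) => x _; rewrite big_ord0.
apply: (Ck_ext oU _ (Ck_add oU (IH _ (fun i => Cf (widen_ord (leqnSn n) i))) (Cf ord_max))).
by move=> x _; rewrite big_ord_recr.
Qed.

(** The induction on [k] runs over all [phi]: a partial derivative of the composite is [phi'(f)]
    times one of [f], and [phi'] satisfies the same hypothesis as [phi]. *)
Lemma Ck_scomp k U (J : set R) (phi : R -> R) f : open U ->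
  (forall l t, J t -> derivable (derive1n l phi) t 1) ->
  (forall x, U x -> J (f x)) ->
  Ck_on k U f -> Ck_on k U (fun x => phi (f x)).
Proof.
move=> oU; elim: k phi f => [|k IH] phi f sphi UJ Cf.
  split=> // x Ux; apply: continuous_comp; first exact: Cf.1.
  exact/differentiable_continuous/derivable1_diffP/(sphi 0)/UJ.
have [cf df] := Cf.
have Dphi x : U x -> is_derive (f x) 1 phi (derive1 phi (f x)).
  by move=> Ux; rewrite derive1E; exact/derivableP/(sphi 0)/UJ.
split=> [x Ux|i].
  apply: continuous_comp; first exact: cf.
  exact/differentiable_continuous/derivable1_diffP/(sphi 0)/UJ.
have [dfi Cfi] := df i.
have D x : U x -> is_derive x (delta_mx 0 i) (fun x => phi (f x))
    (derive1 phi (f x) * pderiv i f x).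
  by move=> Ux; apply: is_derive_scomp; [exact: Dphi|exact/derivableP/dfi].
split=> [x Ux|]; first by have [] := D x Ux.
have sphi' l t : J t -> derivable (derive1n l (derive1 phi)) t 1.
  by rewrite -derive1Sn; exact: sphi.
apply: (Ck_ext oU _ (Ck_mul oU (IH _ _ sphi' UJ (Ck_onW Cf)) Cfi)) => x Ux.
by rewrite /pderiv (@derive_val _ _ _ _ _ _ _ (D x Ux)).
Qed.

End CkClosure.

(** * First-order expansion and comparison of gradients *)

Section FirstOrderExpansion.
Variables (R : realType).

Lemma is_derive_along_line (V : normedModType R) (f : V -> R) x v (r df : R) :
  is_derive (r *: v + x) v f df -> is_derive r 1 (fun s => f (s *: v + x)) df.
Proof.
move=> /is_derive_lineP D; apply/is_derive_lineP.
apply: (@near_eq_is_derive _ _ _ _ _ _ _ _ _ D).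
by near=> s; rewrite /= [_ *: 1]mulr1 scalerDl addrA.
Unshelve. all: by end_near. Qed.

Lemma ler_row_norm d (v : 'rV[R]_d) (j : 'I_d) : `|v 0 j| <= `|v|.
Proof.
rewrite [`|v|]mx_normrE; exact: (@le_bigmax _ _ _ 0 (fun i => `|v i.1 i.2|) (0, j)).
Qed.

Lemma row_norm_le d (v : 'rV[R]_d) (b : R) : 0 <= b ->
  (forall j, `|v 0 j| <= b) -> `|v| <= b.
Proof.
move=> b0 vb; rewrite [`|v|]mx_normrE; apply/bigmax_leP; split=> // -[i j] _ /=.
by rewrite ord1.
Qed.

(** The successive truncations are the vertices of a path from 0 to [v] with edges parallel to the
    axes. *)
Definition row_trunc d (v : 'rV[R]_d) (k : nat) : 'rV[R]_d :=
  \row_j (if (j < k)%N then v 0 j else 0).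

(** [Ck_on] only speaks of partial derivatives, so [v] is reached one coordinate at a time. On each
    edge the mean value theorem yields a partial derivative at a nearby point, which is close to its
    value at [z] by continuity. *)
Lemma C1_expansion d (U : set 'rV[R]_d) (f : 'rV[R]_d -> R) z (e : R) :
  open U -> U z -> Ck_on 1 U f -> 0 < e ->
  \forall v \near (0 : 'rV[R]_d),
    `|f (v + z) - f z - \sum_(j < d) v 0 j * pderiv j f z| <= e * `|v|.
Proof.
move=> oU Uz [cf df] e0.
(* Each of the [d] edges gets the same share of the error; [d.+1] keeps the divisor nonzero. *)
have c0 : 0 < e / d.+1%:R by rewrite divr_gt0.
have : \forall x \near z, U x /\ forall j, `|pderiv j f z - pderiv j f x| < e / d.+1%:R.
  apply: filterI; first exact: open_nbhs_nbhs (conj oU Uz).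
  apply: (@filter_forall _ _ (fun j x => `|pderiv j f z - pderiv j f x| < e / d.+1%:R)
    (nbhs z)) => j; have [dfj [cfj _]] := df j.
  by have /cvgr_dist_lt := cfj z Uz; apply.
move=> /nbhs0P/nbhs_norm0P[del /= del0 Hdel].
apply/nbhs_norm0P; exists del => //= v /= vdel.
(* In the sup norm no point of the path is farther from 0 than [v], so the path stays in the ball of
   radius [del]. *)
have near_seg k (j : 'I_d) (s : R) : 0 <= s <= 1 -> (k = j) ->
    `|(s * v 0 j) *: delta_mx 0 j + row_trunc v k| < del.
  move=> /andP[s0 s1] kj; apply: le_lt_trans vdel; apply: row_norm_le => // l.
  rewrite !mxE kj; case: ltngtP => [lj|lj|/val_inj lj].
  - have -> : (l == j) = false by apply/eqP => E; move: lj; rewrite E ltnn.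
    by rewrite andbF mulr0 add0r ler_row_norm.
  - have -> : (l == j) = false by apply/eqP => E; move: lj; rewrite E ltnn.
    by rewrite andbF mulr0 add0r normr0.
  rewrite lj !eqxx mulr1 addr0 normrM (ger0_norm s0).
  by apply: le_trans (ler_row_norm v j); rewrite ler_piMl.
have step (j : 'I_d) : `|f (row_trunc v j.+1 + z) - f (row_trunc v j + z) -
     v 0 j * pderiv j f z| <= e / d.+1%:R * `|v|.
  have Ej : row_trunc v j.+1 = v 0 j *: delta_mx 0 j + row_trunc v j.
    apply/rowP => l; rewrite !mxE eqxx /= ltnS.
    case: ltngtP => [lj|lj|/val_inj lj].
    - have -> : (l == j) = false by apply/eqP => E; move: lj; rewrite E ltnn.
      by rewrite mulr0 add0r.
    - have -> : (l == j) = false by apply/eqP => E; move: lj; rewrite E ltnn.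
      by rewrite mulr0 add0r.
    by rewrite lj eqxx mulr1 addr0.
  pose w := row_trunc v j + z.
  pose g (s : R) := f ((s * v 0 j) *: delta_mx 0 j + w).
  have Us (s : R) : 0 <= s <= 1 -> U ((s * v 0 j) *: delta_mx 0 j + w) /\
     `|pderiv j f z - pderiv j f ((s * v 0 j) *: delta_mx 0 j + w)| < e / d.+1%:R.
    move=> s01; have [|Ux Hx] := Hdel ((s * v 0 j) *: delta_mx 0 j + row_trunc v j).
      exact: near_seg.
    by split; rewrite ?/w addrA addrC //; exact: Hx.
  have Dg (s : R) : 0 <= s <= 1 ->
     is_derive s 1 g (v 0 j * pderiv j f ((s * v 0 j) *: delta_mx 0 j + w)).
    move=> s01; have [Ux _] := Us s s01; have [dfj _] := df j.
    have D1 := is_derive_along_line (derivableP (dfj _ Ux)).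
    rewrite mulrC.
    apply: (@is_derive1_comp _ (fun r => f (r *: delta_mx 0 j + w))
      (fun s => s * v 0 j)) => //.
    by apply: is_derive_eq; rewrite /= scaler0 add0r [_ *: 1]mulr1.
  have [||c c01] := @MVT_segment _ g
    (fun s => v 0 j * pderiv j f ((s * v 0 j) *: delta_mx 0 j + w)) 0 1 ler01.
  - by move=> s; rewrite in_itv /= => /andP[/ltW s0 /ltW s1]; apply: Dg; rewrite s0.
  - apply: derivable_within_continuous => s; rewrite in_itv /= => s01.
    by have [] := Dg s s01.
  move: c01; rewrite in_itv /= => c01.
  rewrite subr0 mulr1 /g mul0r scale0r add0r mul1r => Hc; rewrite Ej -[_ + _ + z]addrA Hc.
  rewrite -mulrBr normrM mulrC distrC.
  have [_ /ltW H] := Us c c01.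
  by apply: ler_pM => //; exact: ler_row_norm.
have E0 : row_trunc v 0 = 0 by apply/rowP => l; rewrite !mxE.
have Ed : row_trunc v d = v by apply/rowP => l; rewrite !mxE ltn_ord.
have -> : f (v + z) - f z = \sum_(j < d) (f (row_trunc v j.+1 + z) - f (row_trunc v j + z)).
  rewrite -(big_mkord xpredT (fun j => f (row_trunc v j.+1 + z) - f (row_trunc v j + z))).
  by rewrite telescope_sumr // E0 Ed add0r.
rewrite -sumrB; apply: le_trans (ler_norm_sum _ _ _) _.
apply: le_trans (ler_sum _ (fun j _ => step j)) _.
rewrite sumr_const card_ord -[X in X <= _]mulr_natr.
rewrite -(mulrA (e / _)) mulrACA ler_piMr //.
  by rewrite mulr_ge0 // ltW.
by rewrite mulrC ler_pdivrMr // mul1r ler_nat.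
Qed.
End FirstOrderExpansion.

(* Otherwise, with [a] the gradient of [f] and [e] the component of the gradient
   of [g] orthogonal to [a], on a small segment [z + ep (a + th e)], [|th| <= s],
   [f] is positive while [g] changes sign. *)
Lemma parallel_gradients (R : realType) d (U : set 'rV[R]_d)
    (f g : 'rV[R]_d -> R) z :
  open U -> U z -> Ck_on 1 U f -> Ck_on 1 U g ->
  (forall x, U x -> (f x = 0 <-> g x = 0)) -> f z = 0 ->
  (exists j, pderiv j f z != 0) ->
  exists l : R, forall j, pderiv j g z = l * pderiv j f z.
Proof.
move=> oU Uz Cf Cg fg fz [j0 aj0].
have gz : g z = 0 by apply/(fg _ Uz).
set a := fun j => pderiv j f z; set b := fun j => pderiv j g z.
pose A := \sum_j a j ^+ 2; pose B := \sum_j a j * b j.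
have A0 : 0 < A.
  rewrite /A (bigD1 j0) //= ltr_wpDr ?sumr_ge0 // => [i _|].
    exact: sqr_ge0.
  by rewrite exprn_even_gt0.
exists (B / A); pose e j := b j - B / A * a j.
pose E := \sum_j e j ^+ 2.
have aeE l : \sum_j a j * (b j - l * a j) = B - l * A.
  rewrite mulr_sumr -sumrB; apply: eq_bigr => j _; ring.
have ae : \sum_j a j * e j = 0.
  by rewrite aeE divfK ?subrr // gt_eqF.
have be : \sum_j b j * e j = E.
  have -> : E = \sum_j b j * e j - B / A * \sum_j a j * e j.
    rewrite mulr_sumr -sumrB; apply: eq_bigr => j _.
    have -> : b j = e j + B / A * a j by rewrite subrK.
    ring.
  by rewrite ae mulr0 subr0.
have E0 : 0 <= E by apply: sumr_ge0 => j _; exact: sqr_ge0.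
have [E0'|En0] := eqVneq E 0.
  move=> j; apply/eqP; rewrite -subr_eq0 -[_ - _]/(e j) -sqrf_eq0.
  by have /psumr_eq0P -> // : \sum_j e j ^+ 2 = 0; move=> // i _; exact: sqr_ge0.
have {E0 En0} E0 : 0 < E by rewrite lt_neqAle eq_sym En0.
exfalso.
pose ra : 'rV[R]_d := \row_j a j; pose re : 'rV[R]_d := \row_j e j.
(* Chosen so that [B + th * E], the derivative of [g] along [v th], is at least 1 for [th = s] and
   at most -1 for [th = - s]. *)
pose s := (`|B| + 1) / E.
have s0 : 0 < s by rewrite divr_gt0 // ltr_wpDl.
have sE : s * E = `|B| + 1 by rewrite /s divfK // gt_eqF.
pose v (th : R) : 'rV[R]_d := th *: re + ra.
pose C := s * `|re| + `|ra| + 1.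
have C0 : 0 < C by rewrite ltr_wpDl // addr_ge0 // mulr_ge0 // ltW.
have vC (th : R) : - s <= th <= s -> `|v th| <= C.
  move=> ths; rewrite (le_trans (ler_normD _ _)) // /C -addrA lerD //.
    by rewrite normrZ ler_wpM2r // ler_norml.
  by rewrite lerDl.
have va th : \sum_j v th 0 j * a j = A.
  transitivity (A + th * \sum_j a j * e j); last by rewrite ae mulr0 addr0.
  rewrite mulr_sumr /A -big_split /=.
  by apply: eq_bigr => j _; rewrite !mxE; ring.
have vb th : \sum_j v th 0 j * b j = B + th * E.
  rewrite -be mulr_sumr /B -big_split /=.
  by apply: eq_bigr => j _; rewrite !mxE; ring.
(* [C] bounds [v th]. With these tolerances the error at [ep *: v th] is at most half of the linear
   part [ep * A] of [f], and at most [ep / 2] for [g], whose linear part at both ends is at least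
   [ep] in absolute value. *)
have e1 : 0 < A / 2 / C by rewrite !divr_gt0.
have e2 : 0 < 2^-1 / C by rewrite !divr_gt0.
have Hf := C1_expansion oU Uz Cf e1.
have Hg := C1_expansion oU Uz Cg e2.
have HU : \forall v \near (0 : 'rV[R]_d), U (z + v).
  by apply: (nbhs0P U z).1; exact: open_nbhs_nbhs (conj oU Uz).
move: HU Hf Hg => /nbhs_norm0P[d1 /= d10 HU] /nbhs_norm0P[d2 /= d20 Hf]
  /nbhs_norm0P[d3 /= d30 Hg].
pose del := Num.min d1 (Num.min d2 d3).
have del0 : 0 < del by rewrite !lt_min d10 d20.
pose ep := del / 2 / C.
have ep0 : 0 < ep by rewrite !divr_gt0.
have epC : ep * C = del / 2 by rewrite /ep divfK // gt_eqF.
have near_v (th : R) : - s <= th <= s -> `|ep *: v th| < del.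
  move=> /vC vth; rewrite normrZ (gtr0_norm ep0).
  apply: (le_lt_trans (ler_wpM2l (ltW ep0) vth)); rewrite epC; lra.
have Uv (th : R) : - s <= th <= s -> U (ep *: v th + z).
  by move=> /near_v; rewrite lt_min addrC => /andP[/HU].
have sum_ep (c : 'I_d -> R) th :
    \sum_j (ep *: v th) 0 j * c j = ep * \sum_j v th 0 j * c j.
  by rewrite mulr_sumr; apply: eq_bigr => j _; rewrite !mxE mulrA.
have bound (th x y : R) : 0 < x -> - s <= th <= s -> `|y| <= x / C * `|ep *: v th| ->
    `|y| <= x * ep.
  move=> x0 /vC vth /le_trans; apply; rewrite normrZ (gtr0_norm ep0).
  apply: (@le_trans _ _ (x / C * (ep * C))).
    by rewrite ler_pM2l ?divr_gt0 // ler_pM2l.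
  by rewrite mulrA [X in X <= _]mulrAC divfK // gt_eqF.
have A20 : 0 < A / 2 by rewrite divr_gt0.
have fpos (th : R) : - s <= th <= s -> 0 < f (ep *: v th + z).
  move=> ths; move: (near_v _ ths); rewrite !lt_min => /and3P[_ /Hf + _].
  rewrite fz subr0 (sum_ep a) va => /(bound _ _ _ A20 ths).
  rewrite ler_norml => /andP[+ _].
  have := mulr_gt0 A0 ep0; lra.
have gest (th : R) : - s <= th <= s ->
    `|g (ep *: v th + z) - ep * (B + th * E)| <= 2^-1 * ep.
  move=> ths; move: (near_v _ ths); rewrite !lt_min => /and3P[_ _ /Hg].
  by rewrite gz subr0 (sum_ep b) vb => /bound; apply; rewrite ?invr_gt0.
have s_in : - s <= s <= s by apply/andP; split=> //; lra.
have Ns_in : - s <= - s <= s by apply/andP; split=> //; lra.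
have gs : 0 < g (ep *: v s + z).
  have := gest s s_in; rewrite sE ler_norml => /andP[+ _].
  have H : ep * 1 <= ep * (B + (`|B| + 1)).
    by rewrite ler_pM2l //; have := ler_norm (- B); rewrite normrN; lra.
  lra.
have gNs : g (ep *: v (- s) + z) < 0.
  have := gest (- s) Ns_in; rewrite mulNr sE ler_norml => /andP[_ +].
  have H : ep * (B - (`|B| + 1)) <= ep * (- 1).
    by rewrite ler_pM2l //; have := ler_norm B; lra.
  lra.
have [||| th] := @IVT R (fun th => g (ep *: v th + z)) (- s) s 0.
- lra.
- apply: continuous_in_subspaceT => th; rewrite inE /= in_itv /= => ths.
  apply: (@continuous_comp _ _ _ (fun th => ep *: v th + z) g); last exact: (Cg.1 _ (Uv _ ths)).
  apply: continuousD; last exact: cst_continuous.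
  apply: continuousZr; apply: continuousD; last exact: cst_continuous.
  exact: scalel_continuous.
- by rewrite ge_min (ltW gNs) le_max (ltW gs) orbT.
rewrite in_itv /= => ths /(fg _ (Uv _ ths)) fth.
by have := fpos _ ths; rewrite fth ltxx.
Qed.

(** * The metric of H^n x R *)

Section PointwiseRules.
Variables (R : realType) (V : normedModType R) (x v : V).
Implicit Types (f g : V -> R) (df dg : R).

Lemma is_derive_add f g df dg : is_derive x v f df -> is_derive x v g dg ->
  is_derive x v (fun y => f y + g y) (df + dg).
Proof. by move=> Df Dg; exact: is_deriveD. Qed.

Lemma is_derive_sub f g df dg : is_derive x v f df -> is_derive x v g dg ->
  is_derive x v (fun y => f y - g y) (df - dg).
Proof. by move=> Df Dg; exact: is_deriveB. Qed.

Lemma is_derive_mul f g df dg : is_derive x v f df -> is_derive x v g dg ->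
  is_derive x v (fun y => f y * g y) (f x * dg + g x * df).
Proof. by move=> Df Dg; exact: is_deriveM. Qed.

Lemma is_derive_mull a f df : is_derive x v f df ->
  is_derive x v (fun y => a * f y) (a * df).
Proof. by move=> Df; exact: is_deriveZ. Qed.

Lemma is_derive_mulr a f df : is_derive x v f df ->
  is_derive x v (fun y => f y * a) (df * a).
Proof.
move=> Df; rewrite mulrC; have -> : (fun y => f y * a) = (fun y => a * f y).
  by apply/funext => y; rewrite mulrC.
exact: is_derive_mull.
Qed.

Lemma is_derive_sqr f df : is_derive x v f df ->
  is_derive x v (fun y => f y ^+ 2) (2 * f x * df).
Proof.
move=> Df; apply: is_derive_eq (is_derive_mul Df Df) _.
by ring.
Qed.

Lemma is_derive_bigsum n (f : 'I_n -> V -> R) (df : 'I_n -> R) :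
  (forall i, is_derive x v (f i) (df i)) ->
  is_derive x v (fun y => \sum_(i < n) f i y) (\sum_(i < n) df i).
Proof.
move=> Df; have -> : (fun y => \sum_(i < n) f i y) = \sum_(i < n) f i.
  by apply/funext => y; rewrite fct_sumE.
exact: is_derive_sum.
Qed.

Lemma is_derive_div_sqrt f g df dg : 0 < g x ->
  is_derive x v f df -> is_derive x v g dg ->
  is_derive x v (fun y => f y / Num.sqrt (g y))
    ((df * g x - f x * dg / 2) / Num.sqrt (g x) ^+ 3).
Proof.
move=> gx Df Dg.
have s0 : 0 < Num.sqrt (g x) by rewrite sqrtr_gt0.
have Ds := is_derive_scomp (is_derive1_sqrt gx) Dg.
have Di : is_derive x v (fun y => (Num.sqrt (g y))^-1)
    (- Num.sqrt (g x) ^- 2 * ((2 * Num.sqrt (g x))^-1 * dg)).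
  have [E1 E2] := Ds; split; first by apply: derivableV => //; rewrite gt_eqF.
  by rewrite deriveV ?gt_eqF // E2.
apply: is_derive_eq (is_derive_mul Df Di) _.
rewrite -[X in df * X](sqr_sqrtr (ltW gx)).
by field; rewrite gt_eqF.
Qed.

End PointwiseRules.

Section HypRMetric.
Variables (R : realType) (m : nat).
Implicit Types (z : 'rV[R]_(m.+1 + 1)).
Local Notation n := m.+1.

Definition xidx (i : 'I_n) : 'I_(n + 1) := lshift 1 i.
Definition tidx : 'I_(n + 1) := rshift n ord0.
Definition hgt z : R := z 0 (xidx ord_max).

Lemma height_horiz z : height (horiz z) = hgt z.
Proof. by rewrite /height /horiz mxE. Qed.

Lemma sum_coord (f : 'I_(n + 1) -> R) :
  \sum_j f j = \sum_(i < n) f (xidx i) + f tidx.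
Proof. by rewrite big_split_ord /= big_ord1. Qed.

Lemma det_hypR z : 0 < hgt z -> Num.sqrt (\det (hypR_metric z)) = hgt z ^- n.
Proof.
move=> y0; rewrite /hypR_metric det_ublock /hyp_metric det_scalar det1 mulr1.
rewrite height_horiz; have -> : (hgt z ^- 2) ^+ n = (hgt z ^- n) ^+ 2.
  by rewrite -!exprVn -!exprM mulnC.
by rewrite sqrtr_sqr ger0_norm // invr_ge0 exprn_ge0 // ltW.
Qed.

Lemma invmx_hypR z : 0 < hgt z ->
  invmx (hypR_metric z) = block_mx (hgt z ^+ 2)%:M 0 0 1%:M.
Proof.
move=> y0; set B := block_mx _ _ _ _.
have y20 : hgt z ^+ 2 != 0 by rewrite expf_neq0 // gt_eqF.
have E : hypR_metric z *m B = 1%:M.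
  rewrite /hypR_metric /B mulmx_block !(mul0mx, mulmx0, addr0, add0r, mulmx1).
  by rewrite /hyp_metric height_horiz mul_scalar_mx scale_scalar_mx mulVf // -scalar_mx_block.
have [U _] := mulmx1_unit E.
by rewrite -[LHS]mulmx1 -E mulmxA mulVmx // mul1mx.
Qed.

Lemma rgrad_hypR (f : 'rV[R]_(n + 1) -> R) z : 0 < hgt z ->
  (forall i, rgrad hypR_metric f z 0 (xidx i) = hgt z ^+ 2 * pderiv (xidx i) f z) *
  (rgrad hypR_metric f z 0 tidx = pderiv tidx f z).
Proof.
move=> y0; rewrite /rgrad invmx_hypR // -[\row_j _]hsubmxK mul_row_block.
rewrite !mulmx0 addr0 add0r mulmx1 mul_mx_scalar; split=> [i|].
  by rewrite row_mxEl !mxE.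
by rewrite row_mxEr !mxE.
Qed.

Lemma rnorm_hypR z v : 0 < hgt z ->
  rnorm hypR_metric z v =
  Num.sqrt (hgt z ^- 2 * (\sum_(i < n) v 0 (xidx i) ^+ 2) + v 0 tidx ^+ 2).
Proof.
move=> y0; rewrite /rnorm; congr Num.sqrt.
rewrite /hypR_metric -{1}[v]hsubmxK mul_row_block !mulmx0 addr0 add0r mulmx1.
rewrite /hyp_metric height_horiz mul_mx_scalar mxE sum_coord mulr_sumr.
congr (_ + _); first apply: eq_bigr => i _; rewrite ?row_mxEl ?row_mxEr !mxE.
  by rewrite expr2 mulrA.
by rewrite expr2.
Qed.

(** [S] is the squared Riemannian length of the gradient: raising the index multiplies the
    horizontal components by y^2, and the metric weights their squares by y^-2. *)
Lemma unit_grad_hypR (f : 'rV[R]_(n + 1) -> R) z : 0 < hgt z ->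
  let S := hgt z ^+ 2 * (\sum_(i < n) pderiv (xidx i) f z ^+ 2) + pderiv tidx f z ^+ 2 in
  (forall i, unit_grad hypR_metric f z 0 (xidx i) =
     hgt z ^+ 2 * pderiv (xidx i) f z / Num.sqrt S) *
  (unit_grad hypR_metric f z 0 tidx = pderiv tidx f z / Num.sqrt S).
Proof.
move=> y0 S.
have -> : unit_grad hypR_metric f z = (Num.sqrt S)^-1 *: rgrad hypR_metric f z.
  rewrite /unit_grad rnorm_hypR // !rgrad_hypR //; congr ((Num.sqrt (_ + _))^-1 *: _).
  rewrite !mulr_sumr; apply: eq_bigr => i _; rewrite rgrad_hypR //.
  by field; rewrite gt_eqF.
by split=> [i|]; rewrite mxE rgrad_hypR // mulrC.
Qed.

End HypRMetric.

(** * Mean curvature of a family of spheres *)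

(** The form [s ^- n / s] keeps [s ^- n] as a single atom for the later [field] computations with
    symbolic [n]. *)
Lemma is_derive_exprNn (R : realType) (n : nat) (s : R) : s != 0 ->
  is_derive s 1 (fun t : R => t ^- n) (- (n%:R * s ^- n / s)).
Proof.
move=> s0; have sn0 : s ^+ n != 0 by rewrite expf_neq0.
have D : is_derive s 1 (fun t : R => t ^+ n) (n%:R * s ^+ n.-1).
  have -> : (fun t : R => t ^+ n) = id ^+ n by apply/funext => t; rewrite exprfctE.
  by apply: is_derive_eq; rewrite [_ *: _]mulr1.
apply: is_derive_eq (@is_deriveV _ (fun t => t ^+ n) s _ 1 sn0 D) _.
change (- (s ^+ n) ^- 2 * (n%:R * s ^+ n.-1) = - (n%:R * s ^- n / s)).
case: n sn0 {D} => [|n] sn0; first by rewrite !mul0r mulr0 oppr0.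
rewrite [n.+1.-1]/=; move: sn0; rewrite exprS mulf_eq0 negb_or => /andP[_ sn0].
by move: (n.+1%:R) (s ^+ n) sn0 => a p p0; field; rewrite p0 s0.
Qed.

Section SphereFamily.
Variables (R : realType) (m : nat).
Local Notation n := m.+1.
Local Notation pt := 'rV[R]_(n + 1).
Variables (J : set R) (c c1 c2 : 'I_n -> R -> R) (rho rho1 rho2 : R -> R) (ep : R).
Hypothesis oJ : open J.
Hypothesis dc : forall i t, J t -> is_derive t 1 (c i) (c1 i t).
Hypothesis dc1 : forall i t, J t -> is_derive t 1 (c1 i) (c2 i t).
Hypothesis drho : forall t, J t -> is_derive t 1 rho (rho1 t).
Hypothesis drho1 : forall t, J t -> is_derive t 1 rho1 (rho2 t).
Hypothesis ep2 : ep ^+ 2 = 1.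

Definition tcoord (z : pt) : R := z 0 (tidx m).
Definition xoff (i : 'I_n) (z : pt) : R := z 0 (xidx i) - c i (tcoord z).
Definition sqdist (z : pt) : R := \sum_i xoff i z ^+ 2.
(** [ep] is a sign, kept free in order to match a prescribed orientation. *)
Definition sphere_eqn (z : pt) : R := ep * (sqdist z - rho (tcoord z)).
(* The gradient of [sphere_eqn] has components [2 ep (x - c)] and
   [- 2 ep tslope], and hyperbolic length [2 sqrt sqgrad]. *)
Definition tslope (z : pt) : R := \sum_i xoff i z * c1 i (tcoord z) + rho1 (tcoord z) / 2.
Definition sqgrad (z : pt) : R := hgt z ^+ 2 * sqdist z + tslope z ^+ 2.

Lemma sqgrad_gt0 z : 0 < hgt z -> 0 < sqdist z -> 0 < sqgrad z.
Proof. by move=> y0 s0; rewrite /sqgrad ltr_wpDr ?sqr_ge0 // mulr_gt0 // exprn_gt0. Qed.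

Section AtPoint.
Variables (z : pt) (k : 'I_(n + 1)).
Hypothesis Jz : J (tcoord z).
Let e_k : pt := delta_mx 0 k.
(** All directions are treated at once: [t1] and [x1 i] are the derivatives of the vertical and
    horizontal coordinates along [e_k]. *)
Let t1 : R := (k == tidx m)%:R.
Let x1 i : R := (k == xidx i)%:R.

Lemma is_derive_tcoord (phi : R -> R) (a : R) : is_derive (tcoord z) 1 phi a ->
  is_derive z e_k (fun y => phi (tcoord y)) (a * t1).
Proof. by move=> D; apply: is_derive_scomp => //; exact: is_derive_coord. Qed.

Lemma is_derive_xoff i : is_derive z e_k (xoff i) (x1 i - c1 i (tcoord z) * t1).
Proof. apply: is_derive_sub; [exact: is_derive_coord|exact/is_derive_tcoord/dc]. Qed.

Lemma is_derive_sqdist : is_derive z e_k sqdist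
  (\sum_i 2 * xoff i z * (x1 i - c1 i (tcoord z) * t1)).
Proof. by apply: is_derive_bigsum => i; apply/is_derive_sqr/is_derive_xoff. Qed.

Lemma is_derive_sphere_eqn : is_derive z e_k sphere_eqn
  (ep * (\sum_i 2 * xoff i z * (x1 i - c1 i (tcoord z) * t1) - rho1 (tcoord z) * t1)).
Proof.
exact: is_derive_mull (is_derive_sub is_derive_sqdist (is_derive_tcoord (drho Jz))).
Qed.

Lemma is_derive_tslope : is_derive z e_k tslope
  (\sum_i (xoff i z * (c2 i (tcoord z) * t1) + c1 i (tcoord z) * (x1 i - c1 i (tcoord z) * t1))
    + rho2 (tcoord z) * t1 / 2).
Proof.
apply: is_derive_add.
  apply: is_derive_bigsum => i.
  exact: is_derive_mul (is_derive_xoff i) (is_derive_tcoord (dc1 i Jz)).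
exact: is_derive_mulr (is_derive_tcoord (drho1 Jz)).
Qed.

Lemma is_derive_hgt : is_derive z e_k (@hgt R m) (x1 ord_max).
Proof. exact: is_derive_coord. Qed.

End AtPoint.

Let xidx_tidx i : (xidx i == tidx m) = false.
Proof. by rewrite eq_lrshift. Qed.

Let tidx_xidx i : (tidx m == xidx i) = false.
Proof. by rewrite eq_rlshift. Qed.

Let xidx_xidx i j : (xidx i == xidx j :> 'I_(n + 1)) = (i == j).
Proof. by rewrite eq_lshift. Qed.

Lemma sum_delta (f : 'I_n -> R) j : \sum_i f i * (j == i)%:R = f j.
Proof.
rewrite (bigD1 j) //= eqxx mulr1 big1 ?addr0 // => i ij.
by rewrite eq_sym (negbTE ij) mulr0.
Qed.

Lemma is_derive_x_sqdist z j : J (tcoord z) ->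
  is_derive z (delta_mx 0 (xidx j)) sqdist (2 * xoff j z).
Proof.
move=> Jz; apply: is_derive_eq (is_derive_sqdist _ Jz) _.
rewrite -(sum_delta (fun i => 2 * xoff i z)); apply: eq_bigr => i _.
by rewrite xidx_tidx xidx_xidx mulr0 subr0.
Qed.

Lemma is_derive_t_sqdist z : J (tcoord z) ->
  is_derive z (delta_mx 0 (tidx m)) sqdist (- 2 * \sum_i xoff i z * c1 i (tcoord z)).
Proof.
move=> Jz; apply: is_derive_eq (is_derive_sqdist _ Jz) _.
rewrite mulr_sumr; apply: eq_bigr => i _; rewrite tidx_xidx eqxx /=; ring.
Qed.

Lemma is_derive_x_tslope z j : J (tcoord z) ->
  is_derive z (delta_mx 0 (xidx j)) tslope (c1 j (tcoord z)).
Proof.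
move=> Jz; apply: is_derive_eq (is_derive_tslope _ Jz) _.
rewrite xidx_tidx mulr0 mul0r addr0 -[RHS](sum_delta (fun i => c1 i (tcoord z))).
by apply: eq_bigr => i _; rewrite xidx_xidx !mulr0 add0r subr0.
Qed.

(** Half of the second [t]-derivative of [|x - c|^2 - rho]. *)
Definition tcurv (z : pt) : R :=
  \sum_i c1 i (tcoord z) ^+ 2 - \sum_i xoff i z * c2 i (tcoord z) - rho2 (tcoord z) / 2.

Lemma is_derive_t_tslope z : J (tcoord z) ->
  is_derive z (delta_mx 0 (tidx m)) tslope (- tcurv z).
Proof.
move=> Jz; apply: is_derive_eq (is_derive_tslope _ Jz) _.
rewrite /tcurv !opprB eqxx mulr1 addrC; congr (_ + _).
rewrite -sumrB; apply: eq_bigr => i _; rewrite tidx_xidx /=; ring.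
Qed.

Lemma pderiv_x_sphere_eqn z j : J (tcoord z) ->
  pderiv (xidx j) sphere_eqn z = ep * (2 * xoff j z).
Proof.
move=> Jz; rewrite /pderiv (@derive_val _ _ _ _ _ _ _ (is_derive_sphere_eqn (xidx j) Jz)).
rewrite xidx_tidx mulr0 subr0 -[in RHS](sum_delta (fun i => 2 * xoff i z)); congr (_ * _).
by apply: eq_bigr => i _; rewrite xidx_xidx mulr0 subr0.
Qed.

Lemma pderiv_t_sphere_eqn z : J (tcoord z) ->
  pderiv (tidx m) sphere_eqn z = ep * (- 2 * tslope z).
Proof.
move=> Jz; rewrite /pderiv (@derive_val _ _ _ _ _ _ _ (is_derive_sphere_eqn (tidx m) Jz)).
congr (_ * _); rewrite eqxx mulr1 /tslope mulrDr; congr (_ + _); last by field.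
by rewrite mulr_sumr; apply: eq_bigr => i _; rewrite tidx_xidx /=; ring.
Qed.

Lemma unit_grad_sphere z : 0 < hgt z -> J (tcoord z) ->
  (forall i, unit_grad hypR_metric sphere_eqn z 0 (xidx i) =
     ep * (hgt z ^+ 2 * xoff i z) / Num.sqrt (sqgrad z)) *
  (unit_grad hypR_metric sphere_eqn z 0 (tidx m) = - ep * tslope z / Num.sqrt (sqgrad z)).
Proof.
move=> y0 Jz.
have HS : Num.sqrt (hgt z ^+ 2 * (\sum_(i < n) pderiv (xidx i) sphere_eqn z ^+ 2) +
    pderiv (tidx m) sphere_eqn z ^+ 2) = 2 * Num.sqrt (sqgrad z).
  have -> : hgt z ^+ 2 * (\sum_(i < n) pderiv (xidx i) sphere_eqn z ^+ 2) +
    pderiv (tidx m) sphere_eqn z ^+ 2 = 2 ^+ 2 * sqgrad z.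
    have -> : \sum_(i < n) pderiv (xidx i) sphere_eqn z ^+ 2 = 2 ^+ 2 * sqdist z.
      rewrite /sqdist mulr_sumr; apply: eq_bigr => i _.
      by rewrite pderiv_x_sphere_eqn // exprMn ep2 mul1r exprMn.
    rewrite pderiv_t_sphere_eqn // exprMn ep2 /sqgrad; ring.
  by rewrite sqrtrM ?sqr_ge0 // sqrtr_sqr ger0_norm.
(* Where the square root is 0, both sides are 0 by the convention [0^-1 = 0]. *)
have [s0|s0] := eqVneq (Num.sqrt (sqgrad z)) 0.
  by split=> [i|]; rewrite unit_grad_hypR // HS s0 mulr0 invr0 !mulr0.
split=> [i|]; rewrite unit_grad_hypR // HS ?pderiv_x_sphere_eqn ?pderiv_t_sphere_eqn //.
  by field; exact: s0.
by field; exact: s0.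
Qed.

(** The volume density is y^-n, so the divergence is y^n times the sum of the partial derivatives of
    y^-n times the components. Each of these is a quotient by [sqrt sqgrad], and the factor
    [sqrt sqgrad ^ 3] clears the denominators of their derivatives. *)
Lemma rdiv_sphere z : 0 < hgt z -> J (tcoord z) -> 0 < sqdist z ->
  let y := hgt z in let s := sqdist z in let xn := xoff ord_max z in
  let B := \sum_i xoff i z * c1 i (tcoord z) in
  rdiv hypR_metric (unit_grad hypR_metric sphere_eqn) z * Num.sqrt (sqgrad z) ^+ 3 =
  ep * (sqgrad z * (n%:R * y ^+ 2 + (2 - n%:R) * y * xn + tcurv z) - y ^+ 3 * s * xn
    - y ^+ 4 * s - 2 * y ^+ 2 * tslope z * B - tslope z ^+ 2 * tcurv z).
Proof.
move=> y0 Jz s0 y s xn B; have V0 := sqgrad_gt0 y0 s0.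
have y_neq0 : y != 0 by rewrite gt_eqF.
have nearz : \forall x \near z, 0 < hgt x /\ J (tcoord x).
  apply: filterI.
    have /cvgr_gt := @coord_continuous R 1 (n + 1) 0 (xidx ord_max) z; exact.
  have := @coord_continuous R 1 (n + 1) 0 (tidx m) z; apply.
  exact: open_nbhs_nbhs (conj oJ Jz).
have Dg k (u : pt -> R) (du dV : R) :
    (forall x, 0 < hgt x -> J (tcoord x) ->
       unit_grad hypR_metric sphere_eqn x 0 k * hgt x ^- n = u x / Num.sqrt (sqgrad x)) ->
    is_derive z (delta_mx 0 k) u du -> is_derive z (delta_mx 0 k) sqgrad dV ->
    pderiv k (fun x => Num.sqrt (\det (hypR_metric x)) *
       unit_grad hypR_metric sphere_eqn x 0 k) z =
    (du * sqgrad z - u z * dV / 2) / Num.sqrt (sqgrad z) ^+ 3.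
  move=> E Du DV; have D := is_derive_div_sqrt V0 Du DV.
  rewrite -(@derive_val _ _ _ _ _ _ _ D) /pderiv; apply: near_eq_derive.
  near=> x; have [y0x Jx] : 0 < hgt x /\ J (tcoord x) by near: x.
  by rewrite det_hypR // mulrC E.
pose P1 (k : 'I_(n + 1)) : R := - (n%:R * y ^- n / y) * (k == xidx ord_max)%:R.
have DP k : is_derive z (delta_mx 0 k) (fun x : pt => hgt x ^- n) (P1 k).
  exact: is_derive_scomp (is_derive_exprNn n y_neq0) (is_derive_hgt z k).
have Dy2 k : is_derive z (delta_mx 0 k) (fun x : pt => hgt x ^+ 2)
    (2 * y * (k == xidx ord_max)%:R).
  exact: is_derive_sqr (is_derive_hgt z k).
have DVx j := is_derive_add (is_derive_mul (Dy2 (xidx j)) (is_derive_x_sqdist j Jz))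
  (is_derive_sqr (is_derive_x_tslope j Jz)).
have DVt := is_derive_add (is_derive_mul (Dy2 (tidx m)) (is_derive_t_sqdist Jz))
  (is_derive_sqr (is_derive_t_tslope Jz)).
have Dux j := is_derive_mull ep (is_derive_mul (DP (xidx j))
  (is_derive_mul (Dy2 (xidx j)) (is_derive_xoff (xidx j) Jz j))).
have Dut := is_derive_mull (- ep) (is_derive_mul (DP (tidx m)) (is_derive_t_tslope Jz)).
have Ex j x : 0 < hgt x -> J (tcoord x) ->
    unit_grad hypR_metric sphere_eqn x 0 (xidx j) * hgt x ^- n =
    ep * (hgt x ^- n * (hgt x ^+ 2 * xoff j x)) / Num.sqrt (sqgrad x).
  by move=> y0x Jx; rewrite unit_grad_sphere //; ring.
have Et x : 0 < hgt x -> J (tcoord x) ->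
    unit_grad hypR_metric sphere_eqn x 0 (tidx m) * hgt x ^- n =
    - ep * (hgt x ^- n * tslope x) / Num.sqrt (sqgrad x).
  by move=> y0x Jx; rewrite unit_grad_sphere //; ring.
have Px j := Dg _ _ _ _ (Ex j) (Dux j) (DVx j).
have Pt := Dg _ _ _ _ Et Dut DVt.
set P := y ^- n; set w3 := Num.sqrt (sqgrad z) ^+ 3.
have P0 : P != 0 by rewrite invr_neq0 // expf_neq0.
have w30 : w3 != 0 by rewrite expf_neq0 // gt_eqF // sqrtr_gt0.
clear Ex Et.
(* The summand with [ord_max == j] collects the derivatives that fall on the height, in the density
   as well as in the metric. *)
have {Px}Ex j : pderiv (xidx j) (fun x => Num.sqrt (\det (hypR_metric x)) *
     unit_grad hypR_metric sphere_eqn x 0 (xidx j)) z =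
   P * ep / w3 * (sqgrad z * y ^+ 2 - y ^+ 4 * xoff j z ^+ 2
     - y ^+ 2 * tslope z * (xoff j z * c1 j (tcoord z))
     + ((2 - n%:R) * y * sqgrad z - y ^+ 3 * s) * (xoff j z * (ord_max == j)%:R)).
  rewrite Px /P1 -/y -/s -/P -/w3 !xidx_xidx xidx_tidx eqxx [j == _]eq_sym /=.
  by field; rewrite y_neq0 w30.
have {Pt}Et : pderiv (tidx m) (fun x => Num.sqrt (\det (hypR_metric x)) *
     unit_grad hypR_metric sphere_eqn x 0 (tidx m)) z =
   P * ep / w3 * (tcurv z * sqgrad z - y ^+ 2 * tslope z * B - tslope z ^+ 2 * tcurv z).
  rewrite Pt /P1 -/y -/s -/P -/w3 tidx_xidx -/B /=.
  by field; rewrite y_neq0 w30.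
rewrite /rdiv det_hypR // -/y -/P sum_coord Et (eq_bigr _ (fun j _ => Ex j)).
rewrite -mulr_sumr big_split !sumrB /= sumr_const card_ord -!mulr_sumr sum_delta.
rewrite -/B -/(sqdist z) -/s -/xn -[_ *+ n]mulr_natr.
by field; rewrite P0 w30.
Unshelve. all: by end_near. Qed.

End SphereFamily.

(** * The complexified circle *)

(** The integers below [size p] are distinct in [R] and already too many roots for a nonzero [p]. *)
Lemma poly_eq0_horner (R : numDomainType) (p : {poly R}) :
  (forall x, p.[x] = 0) -> p = 0.
Proof.
move=> p0; apply/eqP/negPn/negP => pn0.
pose rs := [seq i%:R : R | i <- iota 0 (size p)].
have : (size rs < size p)%N.
  apply: max_poly_roots => //; first by apply/allP => x _; apply/eqP; exact: p0.
  rewrite map_inj_uniq ?iota_uniq // => i j /eqP; by rewrite eqr_nat => /eqP.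
by rewrite size_map size_iota ltnn.
Qed.

(* The unit circle is parametrized by [a = 2 x / D], [b = S / D]. At the imaginary
   point [x = kap * 'i], [kap ^+ 2 = (h + r) / (h - r)], the height [Y] vanishes,
   hence so does [A]. *)
Lemma circle_identity (R : rcfType) (k e h r v w q u0 u1 u2 : R) :
  0 < r -> r < h -> k != 0 \/ e != 0 ->
  (forall a b, a ^+ 2 + b ^+ 2 = 1 ->
     let y := h + r * b in let A := r * (a * v + b * w) + q in
     k * (y ^+ 2 * r ^+ 2 + A ^+ 2) ^+ 3 =
     y ^+ 2 * (e * A ^+ 2 + y * (u0 + u1 * a + u2 * b)) ^+ 2) ->
  v = 0 /\ h * w = q.
Proof.
move=> r0 rh ke circ.
pose D : {poly R} := 1 + 'X^2; pose S : {poly R} := 1 - 'X^2.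
pose Y := h *: D + r *: S.
pose A := r *: ((2 * v) *: 'X + w *: S) + q *: D.
pose K := u0 *: D + (2 * u1) *: 'X + u2 *: S.
have Dx x : D.[x] = 1 + x ^+ 2 by rewrite !hornerE.
have D0 x : D.[x] != 0 by rewrite Dx gt_eqF // ltr_pwDl // sqr_ge0.
have Sx x : S.[x] = 1 - x ^+ 2 by rewrite !hornerE.
have Yx x : Y.[x] = h * D.[x] + r * S.[x] by rewrite Dx Sx !hornerE.
have Ax x : A.[x] = r * (2 * v * x + w * S.[x]) + q * D.[x] by rewrite Dx Sx !hornerE.
have Kx x : K.[x] = u0 * D.[x] + 2 * u1 * x + u2 * S.[x] by rewrite Dx Sx !hornerE.
(* Multiplying the hypothesis by [D ^ 6] clears the denominators on both sides. The result holds at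
   every real [x], hence between polynomials, and may then be evaluated at a complex point. *)
have idP : k *: (r ^+ 2 *: Y ^+ 2 + A ^+ 2) ^+ 3 = Y ^+ 2 * (e *: A ^+ 2 + Y * K) ^+ 2.
  apply/eqP; rewrite -subr_eq0; apply/eqP/poly_eq0_horner => x.
  have /circ /= H : (2 * x / D.[x]) ^+ 2 + (S.[x] / D.[x]) ^+ 2 = 1.
    by move: (D0 x); rewrite Sx Dx => ?; field.
  apply/eqP; rewrite hornerE hornerN subr_eq0; apply/eqP.
  have EY : h + r * (S.[x] / D.[x]) = Y.[x] / D.[x].
    by rewrite Yx; move: (D0 x) => ?; field.
  have EA : r * (2 * x / D.[x] * v + S.[x] / D.[x] * w) + q = A.[x] / D.[x].
    by rewrite Ax; move: (D0 x) => ?; field.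
  have EK : u0 + u1 * (2 * x / D.[x]) + u2 * (S.[x] / D.[x]) = K.[x] / D.[x].
    by rewrite Kx; move: (D0 x) => ?; field.
  rewrite EY EA EK in H.
  have {}H : k * (Y.[x] ^+ 2 * r ^+ 2 + A.[x] ^+ 2) ^+ 3 =
     Y.[x] ^+ 2 * (e * A.[x] ^+ 2 + Y.[x] * K.[x]) ^+ 2.
    have -> : k * (Y.[x] ^+ 2 * r ^+ 2 + A.[x] ^+ 2) ^+ 3 = D.[x] ^+ 6 *
      (k * ((Y.[x] / D.[x]) ^+ 2 * r ^+ 2 + (A.[x] / D.[x]) ^+ 2) ^+ 3).
      by move: (D0 x) => ?; field.
    by rewrite H; move: (D0 x) => ?; field.
  rewrite hornerZ horner_exp hornerD hornerZ !horner_exp [r ^+ 2 * _]mulrC H.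
  by rewrite hornerM !horner_exp [(_ + Y * K).[x]]hornerD [(e *: _).[x]]hornerZ
    horner_exp [(Y * K).[x]]hornerM.
pose kap := Num.sqrt ((h + r) / (h - r)).
have hr : 0 < h - r by rewrite subr_gt0.
have hr' : 0 < h + r by rewrite addr_gt0 // (lt_trans r0).
have kap0 : 0 < kap by rewrite sqrtr_gt0 divr_gt0.
have kap2 : kap ^+ 2 = (h + r) / (h - r) by rewrite sqr_sqrtr // ltW ?divr_gt0.
pose rc : {rmorphism R -> R[i]} := real_complex R.
pose z : R[i] := rc kap * 'i%C.
pose ev (p : {poly R}) := (map_poly rc p).[z].
have evD p p' : ev (p + p') = ev p + ev p' by rewrite /ev rmorphD hornerD.
have evM p p' : ev (p * p') = ev p * ev p' by rewrite /ev rmorphM hornerM.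
have evZ c p : ev (c *: p) = rc c * ev p.
  by rewrite /ev -mul_polyC rmorphM /= map_polyC hornerM hornerC.
have evX p n : ev (p ^+ n) = ev p ^+ n by rewrite /ev rmorphXn horner_exp.
have ev'X : ev 'X = z by rewrite /ev map_polyX hornerX.
have ev1 : ev 1 = 1 by rewrite /ev rmorph1 hornerC.
have evN p : ev (- p) = - ev p by rewrite /ev rmorphN hornerN.
have z2 : z ^+ 2 = - rc (kap ^+ 2).
  by rewrite exprMn sqr_i mulrN1 rmorphXn.
have evDE : ev D = rc (1 - kap ^+ 2) by rewrite evD ev1 evX ev'X z2 rmorphB rmorph1.
have evSE : ev S = rc (1 + kap ^+ 2).
  by rewrite evD ev1 evN evX ev'X z2 opprK rmorphD rmorph1.
have evY : ev Y = 0.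
  rewrite evD !evZ evDE evSE -!rmorphM -rmorphD -(rmorph0 rc); congr (rc _).
  by rewrite kap2; field; rewrite gt_eqF.
have evA : ev A = 0.
  (* For [k != 0] the identity at [z] reads [k A^6 = 0]. For [k = 0] the nonzero polynomial [Y] is
     cancelled before evaluating: what remains is [e A^2 + Y K = 0], which at [z] gives
     [e A^2 = 0]. *)
  have [k0|k0] := eqVneq k 0; last first.
    have /(congr1 ev) := idP.
    rewrite evZ evX evD evZ !evX evY expr0n mulr0 add0r evM evX evY expr0n mul0r.
    by move/eqP; rewrite mulf_eq0 fmorph_eq0 (negbTE k0) /= !expf_eq0 /= => /eqP.
  have e0 : e != 0 by case: ke => //; rewrite k0 eqxx.
  have Y0 : Y != 0.
    apply/eqP => /(congr1 (horner^~ 0)) /=; rewrite hornerD !hornerZ Dx Sx horner0.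
    by apply/eqP; rewrite expr0n /= addr0 subr0 !mulr1 gt_eqF.
  move/esym/eqP: idP; rewrite k0 scale0r mulf_eq0 !expf_eq0 (negbTE Y0) /=.
  move=> /eqP/(congr1 ev); rewrite evD evZ evX evM evY mul0r addr0 /ev
    rmorph0 horner0 -/(ev A).
  by move/eqP; rewrite mulf_eq0 fmorph_eq0 (negbTE e0) expf_eq0 => /eqP.
(* As [z] is purely imaginary, [w] and [q] enter only the real part and [v] only the imaginary part;
   the two parts vanish separately. *)
have EA : ev A = rc (r * w * (1 + kap ^+ 2) + q * (1 - kap ^+ 2)) +
   rc (2 * r * v * kap) * 'i%C.
  rewrite evD !evZ evD !evZ ev'X evDE evSE /z !(rmorphD rc, rmorphM rc); ring.
move/eqP: EA; rewrite evA eq_sym eq_complex /= => /andP[].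
rewrite !(mulr0, mulr1, mul0r, subr0, addr0, add0r) => /eqP re /eqP im.
split.
  by move/eqP: im; rewrite !mulf_eq0 (gt_eqF kap0) (gt_eqF r0) pnatr_eq0 /= orbF => /eqP.
move/(congr1 (fun x => x * (h - r))): re; rewrite kap2 mul0r.
have -> : (r * w * (1 + (h + r) / (h - r)) + q * (1 - (h + r) / (h - r))) * (h - r) =
  2 * r * (h * w - q) by field; rewrite gt_eqF.
by move/eqP; rewrite !mulf_eq0 (gt_eqF r0) pnatr_eq0 /= subr_eq0 => /eqP.
Qed.

(** * Stationarity of the centres *)

Lemma unit_grad_parallel (R : realType) d (g : 'rV[R]_d -> 'M[R]_d)
    (f h : 'rV[R]_d -> R) x (l : R) : 0 < l ->
  (forall j, pderiv j f x = l * pderiv j h x) ->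
  unit_grad g f x = unit_grad g h x.
Proof.
move=> l0 fh; have E : rgrad g f x = l *: rgrad g h x.
  rewrite /rgrad scalemxAl; congr (_ *m _).
  by apply/rowP => j; rewrite !mxE fh.
rewrite /unit_grad E; have -> : rnorm g x (l *: rgrad g h x) = l * rnorm g x (rgrad g h x).
  rewrite /rnorm linearZ /= -!scalemxAl -scalemxAr scalerA mxE -expr2.
  by rewrite sqrtrM ?sqr_ge0 // sqrtr_sqr gtr0_norm.
by rewrite scalerA invfM mulrAC mulVf ?mul1r // gt_eqF.
Qed.

Lemma Ck_onS (R : realType) d k (U V : set 'rV[R]_d) f :
  V `<=` U -> Ck_on k U f -> Ck_on k V f.
Proof.
move=> VU; elim: k f => [|k IH] f [cf df]; first by split=> // x /VU; exact: cf.
split=> [x /VU|i]; first exact: cf.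
by have [dfi Cf] := df i; split=> [x /VU|]; [exact: dfi|exact: IH].
Qed.

Lemma open_gt0 (R : realType) d (U : set 'rV[R]_d) (g : 'rV[R]_d -> R) :
  open U -> (forall x, U x -> {for x, continuous g}) ->
  open (U `&` [set x | 0 < g x]).
Proof.
move=> oU cg; rewrite openE => x [Ux /= gx].
apply: filterI; first exact: open_nbhs_nbhs (conj oU Ux).
by have /cvgr_gt := cg x Ux; exact.
Qed.

Lemma rgrad_eq0 (R : realType) d (g : 'rV[R]_d -> 'M[R]_d) (f : 'rV[R]_d -> R) x :
  (forall j, pderiv j f x = 0) -> rgrad g f x = 0.
Proof.
move=> f0; rewrite /rgrad (_ : \row_j _ = 0) ?mul0mx //.
by apply/rowP => j; rewrite !mxE f0.
Qed.

Lemma rgrad_hypR_eq0 (R : realType) m (f : 'rV[R]_(m.+1 + 1) -> R) z j :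
  0 < hgt z -> rgrad hypR_metric f z = 0 -> pderiv j f z = 0.
Proof.
move=> y0 E; have [Ex Et] := rgrad_hypR f y0.
rewrite -(splitK j); case: (fintype.split j) => i /=.
  have /esym/eqP := Ex i; rewrite E mxE mulf_eq0 expf_eq0 (gt_eqF y0) => /eqP; exact.
by rewrite ord1 -Et E mxE.
Qed.

(** * The curvature equation on the slices *)

Section CurvatureEquation.
Variables (R : realType) (m : nat).
Local Notation n := m.+1.
Local Notation pt := 'rV[R]_(n + 1).
Variables (M : set pt) (N : pt -> pt) (H : R).
Variables (J : set R) (c c1 c2 : 'I_n -> R -> R) (rho rho1 rho2 : R -> R).
Hypothesis M_hyp : oriented_hypersurface hypR_metric hypR M N.
Hypothesis M_cmc : mean_curvature hypR_metric hypR M N (fun=> H).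
Hypothesis oJ : open J.
Hypothesis dc : forall i t, J t -> is_derive t 1 (c i) (c1 i t).
Hypothesis dc1 : forall i t, J t -> is_derive t 1 (c1 i) (c2 i t).
Hypothesis drho : forall t, J t -> is_derive t 1 rho (rho1 t).
Hypothesis drho1 : forall t, J t -> is_derive t 1 rho1 (rho2 t).
Hypothesis sc : forall i k (U : set pt), open U -> (forall z, U z -> J (tcoord z)) ->
  Ck_on k U (fun z => c i (tcoord z)).
Hypothesis srho : forall k (U : set pt), open U -> (forall z, U z -> J (tcoord z)) ->
  Ck_on k U (fun z => rho (tcoord z)).
Hypothesis rho0 : forall t, J t -> 0 < rho t.
Hypothesis ME : forall z, J (tcoord z) ->
  M z <-> 0 < hgt z /\ sqdist c z = rho (tcoord z).

Let F := sphere_eqn c rho.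

Lemma smooth_xoff (U : set pt) i : open U -> (forall z, U z -> J (tcoord z)) ->
  smooth_on U (xoff c i).
Proof.
move=> oU UJ k; apply: (@Ck_ext _ _ _ _ (fun z => z 0 (xidx i) + (-1) * c i (tcoord z))) => //.
  by move=> x _; rewrite /xoff mulN1r.
apply: Ck_add => //; first exact: Ck_coord.
by apply: Ck_mul => //; [exact: Ck_cst|exact: sc].
Qed.

Lemma smooth_sqdist (U : set pt) : open U -> (forall z, U z -> J (tcoord z)) ->
  smooth_on U (sqdist c).
Proof.
move=> oU UJ k; apply: (@Ck_ext _ _ _ _ (fun z => \sum_i xoff c i z * xoff c i z)) => //.
by apply: Ck_sum => // i; apply: Ck_mul => //; exact: smooth_xoff.
Qed.

Lemma smooth_sphere_eqn ep (U : set pt) : open U -> (forall z, U z -> J (tcoord z)) ->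
  smooth_on U (F ep).
Proof.
move=> oU UJ k.
apply: (@Ck_ext _ _ _ _ (fun z => ep * (sqdist c z + (-1) * rho (tcoord z)))) => //.
  by move=> x _; rewrite mulN1r.
apply: Ck_mul => //; first exact: Ck_cst.
apply: Ck_add => //; first exact: smooth_sqdist.
by apply: Ck_mul => //; [exact: Ck_cst|exact: srho].
Qed.

(** The curvature hypothesis applies only to local equations inducing [N]. Near [z] the given
    equation [f] and the global one have the same zeros, hence parallel gradients on [M]; after
    adjusting the sign [ep], the global equation induces [N] too. Squaring the curvature formula
    removes both [ep] and the square root. *)
Lemma sphere_curvature_eq z : M z -> J (tcoord z) ->
  let y := hgt z in let s := sqdist c z in let xn := xoff c ord_max z in
  let A := tslope c c1 rho1 z in let K := tcurv c c1 c2 rho2 z in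
  let V := y ^+ 2 * s + A ^+ 2 in
  let B := \sum_i xoff c i z * c1 i (tcoord z) in
  (n%:R * H) ^+ 2 * V ^+ 3 =
  (V * (n%:R * y ^+ 2 + (2 - n%:R) * y * xn + K) - y ^+ 3 * s * xn
    - y ^+ 4 * s - 2 * y ^+ 2 * A * B - A ^+ 2 * K) ^+ 2.
Proof.
move=> Mz Jz y s xn A K V B.
have [_ /(_ z Mz)[U' [f [U'z [oU' U'D sf gf Mf] orf]]]] := M_hyp.
have [y0 sz] := (ME Jz).1 Mz.
have s0 : 0 < sqdist c z by rewrite sz rho0.
pose W0 := [set x : pt | [/\ U' x, 0 < hgt x & J (tcoord x)]].
have oW0 : open W0.
  rewrite openE => x [U'x yx Jx].
  have nU : \forall x \near x, U' x by exact: open_nbhs_nbhs (conj oU' U'x).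
  have ny : \forall x \near x, 0 < hgt x.
    by have /cvgr_gt := @coord_continuous R 1 (n + 1) 0 (xidx ord_max) x; exact.
  have nJ : \forall x \near x, J (tcoord x).
    have := @coord_continuous R 1 (n + 1) 0 (tidx m) x; apply.
    exact: open_nbhs_nbhs (conj oJ Jx).
  by near=> w; split; near: w.
(* Away from the centres the horizontal gradient of [F] does not vanish. *)
pose W := W0 `&` [set x | 0 < sqdist c x].
have W0J x : W0 x -> J (tcoord x) by case.
have oW : open W.
  by apply: open_gt0 => // x W0x; exact: ((smooth_sqdist oW0 W0J) 0%N).1.
have WJ x : W x -> J (tcoord x) by move=> [/W0J].
have Wz : W z by [].
have MW x : W x -> M x <-> F 1 x = 0.
  move=> [[_ yx Jx] _]; rewrite ME // /F /sphere_eqn mul1r; split.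
    by move=> [_ ->]; rewrite subrr.
  by move/eqP; rewrite subr_eq0 => /eqP.
have MfW x : W x -> M x <-> f x = 0.
  move=> [[U'x _ _] _]; have : (M `&` U') x <-> [set x | U' x /\ f x = 0] x by rewrite Mf.
  by move=> [E1 E2]; split=> [Mx|fx]; [have [] := E1|have [] := E2].
have sfW : smooth_on W f.
  by move=> k; apply: (Ck_onS _ (sf k)) => x [[]].
have grad_neq0 (ep : R) x : ep != 0 -> W x -> exists j, pderiv j (F ep) x != 0.
  move=> ep0 [[_ _ Jx] /= sx]; apply/existsP; apply: contraPT (sx).
  rewrite negb_exists => /forallP E; rewrite /sqdist big1 ?ltxx // => i _.
  have /eqP := negbNE (E (xidx i)); rewrite pderiv_x_sphere_eqn //.
  by move/eqP; rewrite !mulf_eq0 (negbTE ep0) pnatr_eq0 => /eqP ->; rewrite expr0n.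
have par x : W x -> M x -> exists l : R, l != 0 /\
    forall j, pderiv j f x = l * pderiv j (F 1) x.
  move=> Wx Mx.
  have [|||l Hl] := @parallel_gradients R (n + 1) W (F 1) f x oW Wx
     (smooth_sphere_eqn 1 oW WJ 1%N) (sfW 1%N).
  - by move=> w Ww; rewrite -MW // MfW.
  - by apply/MW.
  - exact: grad_neq0.
  exists l; split=> //; apply/eqP => l0; case: Wx => -[U'x _ _] _.
  move/eqP: (gf x U'x); apply.
  by apply: rgrad_eq0 => j; rewrite Hl l0 mul0r.
(* On [M], [dot] has the sign of the proportionality factor [l]. Being continuous on all of [W], it
   keeps this sign on an open neighbourhood of [z]. *)
pose dot x := \sum_j pderiv j (F 1) x * pderiv j f x.
have dotE x l : (forall j, pderiv j f x = l * pderiv j (F 1) x) ->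
    dot x = l * \sum_j pderiv j (F 1) x ^+ 2.
  by move=> Hl; rewrite mulr_sumr; apply: eq_bigr => j _; rewrite Hl; ring.
have gg x : W x -> 0 < \sum_j pderiv j (F 1) x ^+ 2.
  move=> /(grad_neq0 _ _ (oner_neq0 _)) [j0 aj0].
  rewrite (bigD1 j0) //= ltr_wpDr ?sumr_ge0 // => [i _|]; first exact: sqr_ge0.
  by rewrite exprn_even_gt0.
have [lz [lz0 Hlz]] := par z Wz Mz.
(* The sign for which [F ep] and [f] induce the same orientation. *)
pose ep := Num.sg lz.
have ep2 : ep ^+ 2 = 1 by rewrite sqr_sg lz0.
have ep0 : ep != 0 by rewrite sgr_eq0.
pose U := W `&` [set x | 0 < ep * dot x].
have oU : open U.
  have Cdot : Ck_on 0 W (fun x => ep * dot x).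
    apply: Ck_mul => //; first exact: Ck_cst.
    apply: Ck_sum => // j; apply: Ck_mul => //.
      exact: ((smooth_sphere_eqn 1 oW WJ 1%N).2 j).2.
    exact: ((sfW 1%N).2 j).2.
  by apply: open_gt0 => // x; exact: Cdot.1.
have UW x : U x -> W x by case.
have Uz : U z.
  split=> //=; rewrite (dotE _ _ Hlz) mulrA -normrEsg; apply: mulr_gt0 (gg z Wz).
  by rewrite normr_gt0.
have Fep x j : J (tcoord x) -> pderiv j (F ep) x = ep * pderiv j (F 1) x.
  move=> Jx; rewrite /pderiv /F.
  rewrite (@derive_val _ _ _ _ _ _ _ (is_derive_sphere_eqn ep dc drho j Jx)).
  by rewrite (@derive_val _ _ _ _ _ _ _ (is_derive_sphere_eqn 1 dc drho j Jx)) mul1r.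
have locF : local_equation hypR_metric hypR M U (F ep).
  split=> //.
  - by move=> x [[[/U'D]]].
  - by apply: smooth_sphere_eqn => // x /UW/WJ.
  - move=> x /UW Wx; have [j0 aj0] := grad_neq0 _ _ ep0 Wx.
    case: Wx => -[_ yx _] _; apply: contraNN aj0 => /eqP E.
    by apply/eqP; exact: rgrad_hypR_eq0.
  - have FE x : F ep x = ep * F 1 x by rewrite /F /sphere_eqn mul1r.
    apply/seteqP; split=> x [].
      by move=> Mx Ux; split=> //; rewrite FE ((MW x (UW x Ux)).1 Mx) mulr0.
    move=> Ux /eqP; rewrite FE mulf_eq0 (negbTE ep0) => /eqP Fx; split=> //.
    exact/(MW x (UW x Ux)).
have orF : oriented_by hypR_metric M U N (F ep).
  move=> x [Mx Ux]; have Wx := UW x Ux; rewrite orf; last by case: Wx => -[].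
  have [l [l0 Hl]] := par x Wx Mx; congr (- _).
  apply: (@unit_grad_parallel _ _ _ _ _ _ (l * ep)).
    case: Ux => _ /=; rewrite (dotE _ _ Hl) mulrA [ep * l]mulrC.
    by rewrite pmulr_lgt0 // gg.
  move=> j; rewrite Fep ?Hl; last exact: WJ.
  by rewrite -mulrA [ep * (ep * _)]mulrA -expr2 ep2 mul1r.
have V0 : 0 < V by exact: sqgrad_gt0.
have := M_cmc locF orF (conj Mz Uz); have -> : (n + 1).-1 = n by rewrite addn1.
rewrite -[(fun=> H) z]/H => E.
have /= := rdiv_sphere oJ dc dc1 drho drho1 ep2 y0 Jz s0.
rewrite -/F -/s -/y -/xn -/A -/B -/K -[sqgrad _ _ _ _]/V.
set Q := (X in ep * X) => EQ.
have -> : Q ^+ 2 = (ep * Q) ^+ 2 by rewrite exprMn ep2 mul1r.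
rewrite -EQ [(rdiv _ _ _ * _) ^+ 2]exprMn E sqrrN; congr (_ * _).
by rewrite -exprM mulnC exprM sqr_sqrtr // ltW.
Unshelve. all: by end_near. Qed.

Section Stationary.
Variables (t0 : R) (i : 'I_n).
Hypotheses (Jt0 : J t0) (i_hor : i != ord_max) (h0 : 0 < c ord_max t0).
Hypothesis rho_h : rho t0 < c ord_max t0 ^+ 2.
Hypothesis H_or_n : H <> 0 \/ (H = 0 /\ (3 <= n)%N).

Let r := Num.sqrt (rho t0).
Let h := c ord_max t0.

(** For a horizontal index [i] and [a^2 + b^2 = 1], these points form the great circle cut out of
    the slice at [t0] by the plane through its Euclidean centre parallel to axis [i] and to the
    height axis. *)
Definition circle_pt (a b : R) : pt :=
  row_mx (\row_j (c j t0 + r * (a * (i == j)%:R + b * (ord_max == j)%:R))) t0%:M.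

Lemma tcoord_circle_pt a b : tcoord (circle_pt a b) = t0.
Proof. by rewrite /tcoord /circle_pt row_mxEr mxE mulr1n. Qed.

Lemma xoff_circle_pt a b j :
  xoff c j (circle_pt a b) = r * (a * (i == j)%:R + b * (ord_max == j)%:R).
Proof. by rewrite /xoff tcoord_circle_pt /circle_pt row_mxEl mxE addrC addKr. Qed.

Lemma sum_circle_pt a b (f : 'I_n -> R) :
  \sum_j xoff c j (circle_pt a b) * f j = r * (a * f i + b * f ord_max).
Proof.
rewrite -(sum_delta f i) -(sum_delta f ord_max) !mulr_sumr -big_split /= mulr_sumr.
by apply: eq_bigr => j _; rewrite xoff_circle_pt; ring.
Qed.

(** The curvature equation restricted to this circle is the hypothesis of [circle_identity]. The
    second conclusion says that [h^2 - rho] has zero derivative at [t0]. *)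
Lemma sphere_stationary : c1 i t0 = 0 /\ h * c1 ord_max t0 = rho1 t0 / 2.
Proof.
have r0 : 0 < r by rewrite sqrtr_gt0 rho0.
have r2 : r ^+ 2 = rho t0 by rewrite sqr_sqrtr // ltW // rho0.
have rh : r < h by rewrite -(@ltr_pXn2r _ 2) ?nnegrE ?ltW // r2.
have ke : (n%:R * H) ^+ 2 != 0 \/ (n%:R - 2) * h != 0.
  case: H_or_n => [/eqP H0|[_ n3]]; [left|right].
    by rewrite expf_neq0 // mulf_neq0 // pnatr_eq0.
  by rewrite mulf_neq0 ?(gt_eqF h0) // subr_eq0 eqr_nat; case: (n) n3 => [|[|[]]].
pose q := rho1 t0 / 2; pose v := c1 i t0; pose w := c1 ord_max t0.
pose C0 := \sum_j c1 j t0 ^+ 2 - rho2 t0 / 2.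
(* The three constants are the coefficients of 1, [a] and [b] in
   [r^2 ((n - 1) h y + tcurv) + 2 q A]. Substituting [xn = y - h] and [B = A - q] in the curvature
   equation cancels the terms [2 y^2 A^2] and [A^2 tcurv], and leaves y times the sum of
   [(n - 2) h A^2] and y times this expression. *)
apply: (@circle_identity R _ _ h r v w q
  (r ^+ 2 * (n%:R - 1) * h ^+ 2 + 2 * q * q + r ^+ 2 * C0)
  (2 * q * r * v - r ^+ 3 * c2 i t0)
  (r ^+ 2 * (n%:R - 1) * h * r + 2 * q * r * w - r ^+ 3 * c2 ord_max t0) r0 rh ke).
move=> a b ab y A; pose z := circle_pt a b.
have tz : tcoord z = t0 by exact: tcoord_circle_pt.
have xn : xoff c ord_max z = r * b.
  by rewrite xoff_circle_pt eqxx (negbTE i_hor) mulr0 add0r mulr1.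
have xii : xoff c i z = r * a.
  by rewrite xoff_circle_pt eqxx eq_sym (negbTE i_hor) mulr0 addr0 mulr1.
have sgz : sqdist c z = r ^+ 2.
  rewrite /sqdist; under eq_bigr do rewrite expr2.
  by rewrite sum_circle_pt -/z xn xii -[RHS]mulr1 -ab; ring.
have hz : hgt z = y.
  by rewrite -[hgt z](subrK (c ord_max (tcoord z))) -[_ - _]/(xoff c ord_max z) xn tz addrC.
have y0 : 0 < y.
  have b1 : -1 <= b.
    by rewrite leNgt; apply/negP => b1; have := sqr_ge0 a; nra.
  have := ler_wpM2l (ltW r0) b1; rewrite /y; lra.
have Mz : M z by apply/ME; rewrite tz // hz sgz r2.
have Jz : J (tcoord z) by rewrite tz.
have Az : tslope c c1 rho1 z = A.
  by rewrite /tslope tz sum_circle_pt.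
have Cz : tcurv c c1 c2 rho2 z = C0 - r * (a * c2 i t0 + b * c2 ord_max t0).
  by rewrite /tcurv tz sum_circle_pt /C0; ring.
have := sphere_curvature_eq Mz Jz.
rewrite /= hz sgz xn Az Cz tz sum_circle_pt => ->.
rewrite -[RHS]exprMn; congr (_ ^+ 2).
rewrite -/v -/w /A /y; ring.
Qed.

End Stationary.

End CurvatureEquation.

(** * Hyperbolic spheres as Euclidean spheres *)

Section HyperbolicSpheres.
Variable R : realType.

Definition cosh (s : R) : R := (expR s + expR (- s)) / 2.

Lemma expR_mulN (s : R) : expR s * expR (- s) = 1.
Proof. by rewrite -expRD subrr expR0. Qed.

Lemma cosh_gt1 s : 0 < s -> 1 < cosh s.
Proof.
move=> s0; have := expR_mulN s; have : 1 < expR s by rewrite expR_gt1.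
have := expR_gt0 (- s); rewrite /cosh; nra.
Qed.

(** The numbers [u + sqrt (u^2 - 1)] and [u - sqrt (u^2 - 1)] are inverse to each other, so they are
    the exponentials of [s] and [- s]. *)
Lemma arcosh_eq (u s : R) : 1 <= u -> 0 < s -> arcosh u = s <-> u = cosh s.
Proof.
move=> u1 s0; have u2 : 0 <= u ^+ 2 - 1 by nra.
rewrite /arcosh /cosh; split=> [us|->].
  have v0 : 0 < u + Num.sqrt (u ^+ 2 - 1).
    by rewrite ltr_pwDl // (lt_le_trans ltr01).
  have es : expR s = u + Num.sqrt (u ^+ 2 - 1) by rewrite -us lnK.
  have eNs : expR (- s) = u - Num.sqrt (u ^+ 2 - 1).
    apply: (mulfI (lt0r_neq0 v0)); transitivity (1 : R).
      by rewrite -es expR_mulN.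
    have -> : (u + Num.sqrt (u ^+ 2 - 1)) * (u - Num.sqrt (u ^+ 2 - 1)) =
       u ^+ 2 - Num.sqrt (u ^+ 2 - 1) ^+ 2 by ring.
    by rewrite sqr_sqrtr //; ring.
  by rewrite es eNs; field.
have -> : ((expR s + expR (- s)) / 2) ^+ 2 - 1 = ((expR s - expR (- s)) / 2) ^+ 2.
  by rewrite -[X in _ - X](expR_mulN s); field.
rewrite sqrtr_sqr ger0_norm.
  have -> : (expR s + expR (- s)) / 2 + (expR s - expR (- s)) / 2 = expR s by field.
  exact: expRK.
by rewrite divr_ge0 // subr_ge0 ler_expR; lra.
Qed.

(** With y and b the heights of [x] and [p], distance [s] means [|x - p|^2 = 2 y b (cosh s - 1)].
    Completing the square in y raises the centre to the height [b cosh s] and gives the radius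
    [b sinh s]. *)
Lemma hyp_sphereE m (p x : 'rV[R]_m.+1) (s : R) : hyp p -> 0 < s ->
  let k := height p * cosh s in
  hyp_sphere p s x <->
  hyp x /\ \sum_i (x 0 i - (if i == ord_max then k else p 0 i)) ^+ 2 =
           k ^+ 2 - height p ^+ 2.
Proof.
rewrite /hyp_sphere /hyp /= => p0 s0.
suff E : 0 < height x -> hyp_dist x p = s <->
  \sum_i (x 0 i - (if i == ord_max then height p * cosh s else p 0 i)) ^+ 2 =
  (height p * cosh s) ^+ 2 - height p ^+ 2.
  by split=> -[x0 D]; split=> //; apply/(E x0).
move=> x0; rewrite /hyp_dist arcosh_eq //; last first.
  by rewrite lerDl divr_ge0 ?sumr_ge0 ?mulr_ge0 ?ltW // => i _; exact: sqr_ge0.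
rewrite (bigD1 ord_max) //= [X in _ <-> X = _](bigD1 ord_max) //= eqxx.
rewrite -[x 0 ord_max]/(height x) -[p 0 ord_max]/(height p).
have -> : \sum_(i < m.+1 | i != ord_max)
    (x 0 i - (if i == ord_max then height p * cosh s else p 0 i)) ^+ 2 =
  \sum_(i < m.+1 | i != ord_max) (x 0 i - p 0 i) ^+ 2.
  by apply: eq_bigr => i /negbTE ->.
set T := \sum_(i < m.+1 | _) _; set C := cosh s; set y := height x; set b := height p.
have yb0 : 2 * y * b != 0 by rewrite !mulf_neq0 // gt_eqF.
split=> [<-|E].
  by field; move: yb0; rewrite !mulf_eq0 !negb_or => /andP[/andP[_ -> ->]].
have -> : T = (b * C) ^+ 2 - b ^+ 2 - (y - b * C) ^+ 2 by rewrite -E; ring.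
by field; move: yb0; rewrite !mulf_eq0 !negb_or => /andP[/andP[_ -> ->]].
Qed.

End HyperbolicSpheres.

(** * Functions of time with two derivatives *)

Section TwiceDerivable.
Variables (R : realType) (J : set R).

(** Mean curvature is of second order. The derivatives are carried as functions, to be handed to the
    curvature computation as [c1], [c2], [rho1], [rho2]. *)
Definition twice_derivable (f : R -> R) := exists f1 f2 : R -> R,
  (forall t, J t -> is_derive t 1 f (f1 t)) /\
  (forall t, J t -> is_derive t 1 f1 (f2 t)).

Lemma twice_derivable_mul f g : twice_derivable f -> twice_derivable g ->
  twice_derivable (fun t => f t * g t).
Proof.
move=> [f1 [f2 [Df1 Df2]]] [g1 [g2 [Dg1 Dg2]]].
exists (fun t => f t * g1 t + g t * f1 t).
exists (fun t => (f t * g2 t + g1 t * f1 t) + (g t * f2 t + f1 t * g1 t)).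
split=> t Jt; first by apply: is_derive_mul; [exact: Df1|exact: Dg1].
by apply: is_derive_add; apply: is_derive_mul;
  [exact: Df1|exact: Dg2|exact: Dg1|exact: Df2].
Qed.

Lemma twice_derivable_add f g : twice_derivable f -> twice_derivable g ->
  twice_derivable (fun t => f t + g t).
Proof.
move=> [f1 [f2 [Df1 Df2]]] [g1 [g2 [Dg1 Dg2]]].
exists (fun t => f1 t + g1 t), (fun t => f2 t + g2 t).
by split=> t Jt; apply: is_derive_add; [exact: Df1|exact: Dg1|exact: Df2|exact: Dg2].
Qed.

Lemma twice_derivable_mull a f : twice_derivable f ->
  twice_derivable (fun t => a * f t).
Proof.
move=> [f1 [f2 [Df1 Df2]]]; exists (fun t => a * f1 t), (fun t => a * f2 t).
by split=> t Jt; apply: is_derive_mull; [exact: Df1|exact: Df2].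
Qed.

Lemma twice_derivable_expR f : twice_derivable f ->
  twice_derivable (fun t => expR (f t)).
Proof.
move=> [f1 [f2 [Df1 Df2]]]; exists (fun t => expR (f t) * f1 t).
exists (fun t => expR (f t) * f2 t + f1 t * (expR (f t) * f1 t)).
have D t : J t -> is_derive t 1 (fun t => expR (f t)) (expR (f t) * f1 t).
  by move=> Jt; apply: is_derive_scomp (is_derive_expR _) (Df1 t Jt).
by split=> t Jt; [exact: D|apply: is_derive_mul; [exact: D|exact: Df2]].
Qed.

Lemma twice_derivable_smooth f :
  (forall l t, J t -> derivable (derive1n l f) t 1) -> twice_derivable f.
Proof.
move=> sf; exists (derive1 f), (derive1 (derive1 f)).
by split=> t Jt; rewrite derive1E; apply: derivableP; [exact: (sf 0%N)|exact: (sf 1%N)].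
Qed.

End TwiceDerivable.

(** * Constancy of the hyperbolic centre *)

Lemma derive1n_expR (R : realType) l : derive1n l (@expR R) = expR.
Proof.
elim: l => [|l IH] //; rewrite derive1nS IH; apply/funext => t.
by rewrite derive1E derive_val.
Qed.

(** The derivative is asked to vanish only inside the interval, because stationarity is obtained on
    an open set of times; derivability at the ends supplies the continuity for the mean value
    theorem. *)
Lemma is_derive0_eq (R : realType) (f : R -> R) (a b : R) : a <= b ->
  (forall t, a <= t <= b -> derivable f t 1) ->
  (forall t, a < t < b -> 'D_1 f t = 0) -> f a = f b.
Proof.
move=> ab df df0; have [t| |t _] := @MVT_segment R f (fun=> 0) a b ab.
- rewrite in_itv /= => /andP[at_ tb]; apply: DeriveDef.
    by apply: df; rewrite !ltW.
  by apply: df0; rewrite at_ tb.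
- by apply: derivable_within_continuous => t; rewrite in_itv; exact: df.
- by rewrite mul0r => /eqP; rewrite subr_eq0 => /eqP.
Qed.

Lemma smooth1_onW (R : realType) (I J : set R) (f : R -> R) : J `<=` I ->
  smooth1_on I f -> forall l t, J t -> derivable (derive1n l f) t 1.
Proof. by move=> JI [K [_ IK df]] l t /JI/IK; exact: df. Qed.

(** Stationarity holds on the open interval between [t1] and [t2]. There the horizontal coordinates
    of [p] have zero derivative, and so has its squared height, which is the squared height of the
    Euclidean centre minus the squared Euclidean radius. Positivity of the height removes the
    square. *)
Lemma centre_const (R : realType) (m : nat)
    (M : set 'rV[R]_(m.+1 + 1)) (N : 'rV[R]_(m.+1 + 1) -> 'rV[R]_(m.+1 + 1))
    (I : set R) (H : R) (p : R -> 'rV[R]_m.+1) (r : R -> R) (t1 t2 : R) :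
  (2 <= m.+1)%N ->
  oriented_hypersurface hypR_metric hypR M N ->
  mean_curvature hypR_metric hypR M N (fun=> H) ->
  H <> 0 \/ (H = 0 /\ (3 <= m.+1)%N) ->
  is_interval I ->
  (forall i, smooth1_on I (fun t => p t 0 i)) -> smooth1_on I r ->
  (forall t, I t -> [/\ hyp (p t), 0 < r t & slice M t = hyp_sphere (p t) (r t)]) ->
  I t1 -> I t2 -> t1 < t2 -> p t1 = p t2.
Proof.
move=> n2 M_hyp M_cmc H_or_n I_itv sp sr Hs It1 It2 t12.
pose J : set R := `]t1, t2[%classic.
have oJ : open J by exact: interval_open.
have tI t : t1 <= t <= t2 -> I t by exact: (I_itv _ _ It1 It2).
have JI : J `<=` I.
  by move=> t; rewrite /J /= in_itv /= => /andP[a b]; apply: tI; rewrite !ltW.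
pose k t := height (p t) * cosh (r t).
pose c (i : 'I_m.+1) t := if i == ord_max then k t else p t 0 i.
(* Written with sums and products only, to fit the closure lemmas for smoothness; [rhoE] restores
   the usual form. *)
pose rho t := k t * k t + (-1) * (height (p t) * height (p t)).
have rhoE t : rho t = k t ^+ 2 - height (p t) ^+ 2 by rewrite /rho mulN1r.
have sp' i := smooth1_onW JI (sp i); have sr' := smooth1_onW JI sr.
have twp i := twice_derivable_smooth (sp' i).
have twr := twice_derivable_smooth sr'.
have twk : twice_derivable J k.
  have -> : k = (fun t => height (p t) * (2^-1 * (expR (r t) + expR (-1 * r t)))).
    by apply/funext => t; rewrite /k /cosh mulN1r [_ / 2]mulrC.
  apply: twice_derivable_mul; first exact: twp.
  apply/twice_derivable_mull/twice_derivable_add; apply: twice_derivable_expR => //.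
  exact: twice_derivable_mull.
have twc i : twice_derivable J (c i).
  by rewrite /c; case: (i == ord_max).
have [rho1 [rho2 [drho drho1]]] : twice_derivable J rho.
  apply: twice_derivable_add; first exact: twice_derivable_mul.
  apply: twice_derivable_mull; exact: twice_derivable_mul (twp ord_max) (twp ord_max).
have /choice [c1 /choice [c2 dc]] := twc.
have Ck1 (phi : R -> R) l (U : set 'rV[R]_(m.+1 + 1)) : open U ->
    (forall z, U z -> J (tcoord z)) ->
    (forall l t, J t -> derivable (derive1n l phi) t 1) ->
    Ck_on l U (fun z => phi (tcoord z)).
  by move=> oU UJ dphi; apply: (Ck_scomp oU dphi UJ); exact: Ck_coord.
have Ckexp l (U : set 'rV[R]_(m.+1 + 1)) f : open U -> Ck_on l U f ->
    Ck_on l U (fun z => expR (f z)).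
  move=> oU; apply: (@Ck_scomp _ _ _ _ setT) => // j t _; rewrite derive1n_expR.
  exact: derivable_expR.
have Ckk l (U : set 'rV[R]_(m.+1 + 1)) : open U ->
    (forall z, U z -> J (tcoord z)) ->
    Ck_on l U (fun z => k (tcoord z)).
  move=> oU UJ; have Cr := Ck1 r l U oU UJ sr'.
  apply: Ck_mul => //; first exact: Ck1 (sp' ord_max).
  apply: Ck_mul => //; last exact: Ck_cst.
  apply: Ck_add => //; first exact: Ckexp.
  apply: (@Ck_ext _ _ _ _ (fun z => expR (-1 * r (tcoord z)))) => //.
    by move=> x _; rewrite mulN1r.
  by apply: Ckexp => //; apply: Ck_mul => //; exact: Ck_cst.
have sc i l (U : set 'rV[R]_(m.+1 + 1)) : open U ->
    (forall z, U z -> J (tcoord z)) ->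
    Ck_on l U (fun z => c i (tcoord z)).
  by move=> oU UJ; rewrite /c; case: (i == ord_max); [exact: Ckk|exact: Ck1 (sp' i)].
have srho l (U : set 'rV[R]_(m.+1 + 1)) : open U ->
    (forall z, U z -> J (tcoord z)) ->
    Ck_on l U (fun z => rho (tcoord z)).
  move=> oU UJ; apply: Ck_add => //; first by apply: Ck_mul => //; exact: Ckk.
  apply: Ck_mul => //; first exact: Ck_cst.
  by apply: Ck_mul => //; exact: Ck1 (sp' ord_max).
have rho0 t : J t -> 0 < rho t.
  move=> /JI/Hs[p0 r0 _]; rewrite rhoE subr_gt0 /k exprMn ltr_pMr ?exprn_gt0 //.
  by rewrite exprn_egt1 // cosh_gt1.
have ME z : J (tcoord z) -> M z <-> 0 < hgt z /\ sqdist c z = rho (tcoord z).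
  move=> Jz; have [p0 r0 sl] := Hs _ (JI _ Jz).
  have -> : M z = hyp_sphere (p (tcoord z)) (r (tcoord z)) (horiz z).
    rewrite -sl /slice /=; congr M; rewrite -[LHS]hsubmxK; congr row_mx.
    by apply/matrixP => i j; rewrite !ord1 !mxE eqxx mulr1n.
  rewrite hyp_sphereE // /hyp /= height_horiz rhoE.
  by rewrite /sqdist /xoff /c; under eq_bigr do rewrite mxE.
have stat i t := @sphere_stationary R m M N H J c c1 c2 rho rho1 rho2 M_hyp M_cmc oJ
  (fun i => (dc i).1) (fun i => (dc i).2) drho drho1 sc srho rho0 ME t i.
have st i t : J t -> i != ord_max ->
    c1 i t = 0 /\ c ord_max t * c1 ord_max t = rho1 t / 2.
  move=> Jt i_hor; have [p0 r0 _] := Hs t (JI t Jt).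
  have cE : c ord_max t = k t by rewrite /c eqxx.
  have k0 : 0 < k t by rewrite mulr_gt0 // (lt_trans ltr01) // cosh_gt1.
  apply: stat => //; rewrite cE // rhoE.
  by rewrite ltrBlDr ltrDl exprn_gt0.
have dp i t : t1 <= t <= t2 -> derivable (fun t => p t 0 i) t 1.
  by move=> tt; have [K [_ IK dK]] := sp i; exact: (dK 0%N t (IK t (tI t tt))).
apply/rowP => i; have [->|i_hor] := eqVneq i ord_max; last first.
  apply: (@is_derive0_eq _ (fun t => p t 0 i) _ _ (ltW t12)); first exact: dp.
  move=> t tt; have Jt : J t by rewrite /J /= in_itv.
  have D := (dc i).1 t Jt; rewrite (st i t Jt i_hor).1 in D.
  have E : c i = (fun t => p t 0 i) by rewrite /c (negbTE i_hor).
  by rewrite E in D; case: D.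
(* [st] delivers the relation between height and radius along with a horizontal index; one exists
   because [n >= 2]. *)
have [j j_hor] : exists j : 'I_m.+1, j != ord_max.
  by exists ord0; rewrite -val_eqE /= eq_sym -lt0n.
have sq : height (p t1) * height (p t1) = height (p t2) * height (p t2).
  apply: (@is_derive0_eq _ (fun t => height (p t) * height (p t)) _ _ (ltW t12)).
    by move=> t tt; apply: derivableM; exact: dp.
  move=> t tt; have Jt : J t by rewrite /J /= in_itv.
  have -> : (fun t => height (p t) * height (p t)) =
      (fun t => c ord_max t * c ord_max t - rho t).
    by apply/funext => u; rewrite /c eqxx /rho; ring.
  have Dc := (dc ord_max).1 t Jt.
  have [_ ->] := is_derive_sub (is_derive_mul Dc Dc) (drho t Jt).
  by rewrite (st j t Jt j_hor).2; field.
have [[p1 _ _] [p2 _ _]] := (Hs _ It1, Hs _ It2).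
by apply/eqP; rewrite -(eqrXn2 (n := 2)) ?ltW // !expr2; apply/eqP.
Qed.

Theorem theorem2p1 (R : realType) (m : nat) (n_ge2 : (2 <= m.+1)%N)
    (M : set 'rV[R]_(m.+1 + 1)) (N : 'rV[R]_(m.+1 + 1) -> 'rV[R]_(m.+1 + 1))
    (I : set R) (H : R)
    (M_hypersurface : oriented_hypersurface hypR_metric hypR M N)
    (M_foliated : foliated_by_spheres M I)
    (M_cmc : mean_curvature hypR_metric hypR M N (fun=> H))
    (H_or_n : H <> 0 \/ (H = 0 /\ (3 <= m.+1)%N)) :
  rotationally_symmetric M I.
Proof.
have [I_itv [p [r [sp sr Hs _]]]] := M_foliated.
have [[t0 It0]|I0] := pselect (exists t, I t); last first.
  (* With no slices at all, any point of the half-space serves as centre. *)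
  exists (const_mx 1) => [|t It]; first by rewrite /hyp /= /height mxE.
  by case: I0; exists t.

exists (p t0); first by have [] := Hs t0 It0.
move=> t It; have [pt0 rt0 st] := Hs t It; exists (r t) => //.
have centre u v : I u -> I v -> u < v -> p u = p v.
  exact: centre_const n_ge2 M_hypersurface M_cmc H_or_n I_itv sp sr Hs.
rewrite st; congr hyp_sphere.
have [tt0|t0t|->//] := ltgtP t t0; first exact: centre.
by symmetry; exact: centre.
Qed.
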